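(* For every $f\in{\cal N}_1$ there is $C<\infty$ such that $\int_0^{2\pi}\big|\log|f(c+re^{i\theta})|\big|\,d\theta<C$ for all $c\in\mathbb{C}$ and all $r>1$.
   Context: $\rho_S$ is the spherical metric. A meromorphic $f$ on $\mathbb{C}$ is normal if every sequence of translates $f(z+h_n)$ has a subsequence Cauchy in $\rho_S$ uniformly on compacta; $f\in{\cal N}_1$ if moreover no limit of translates is a constant function (including $\infty$). *)

(* Defs.v *)
From Stdlib Require Import Reals.
Open Scope R_scope.

Definition Cpx := (R * R)%type.
Definition Cadd (z w : Cpx) : Cpx := (fst z + fst w, snd z + snd w).
Definition Csub (z w : Cpx) : Cpx := (fst z - fst w, snd z - snd w).
Definition Cmul (z w : Cpx) : Cpx :=
  (fst z * fst w - snd z * snd w, fst z * snd w + snd z * fst w).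
Definition Cnorm (z : Cpx) : R := sqrt (fst z * fst z + snd z * snd z).
Definition Cinv (z : Cpx) : Cpx :=
  let d := fst z * fst z + snd z * snd z in (fst z / d, - snd z / d).
Definition C0 : Cpx := (0, 0).

(* Riemann sphere: None = infinity *)
Definition Csph := option Cpx.

Definition rhoS (a b : Csph) : R :=
  match a, b with
  | Some z, Some w =>
      2 * Cnorm (Csub z w) / sqrt ((1 + Cnorm z ^ 2) * (1 + Cnorm w ^ 2))
  | Some z, None | None, Some z => 2 / sqrt (1 + Cnorm z ^ 2)
  | None, None => 0
  end.

Definition sinv (a : Csph) : Csph :=
  match a with
  | None => Some C0
  | Some z =>
      if Req_EM_T (Cnorm z) 0 then None else Some (Cinv z)
  end.

Definition in_disc (z0 : Cpx) (d : R) (w : Cpx) : Prop := Cnorm (Csub w z0) < d.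

Definition holo_on_disc (g : Cpx -> Cpx) (z0 : Cpx) (d : R) : Prop :=
  forall z, in_disc z0 d z ->
    exists L : Cpx, forall eps, 0 < eps -> exists del, 0 < del /\
      forall w, 0 < Cnorm (Csub w z) < del ->
        Cnorm (Csub (Csub (g w) (g z)) (Cmul L (Csub w z)))
          <= eps * Cnorm (Csub w z).

Definition meromorphic (f : Cpx -> Csph) : Prop :=
  (forall z0 : Cpx, exists d, 0 < d /\ exists g : Cpx -> Cpx, holo_on_disc g z0 d /\
     ((forall w, in_disc z0 d w -> f w = Some (g w)) \/
      (forall w, in_disc z0 d w -> sinv (f w) = Some (g w)))) /\
  (exists z, f z <> None).

Definition translate (f : Cpx -> Csph) (h : Cpx) : Cpx -> Csph :=
  fun z => f (Cadd z h).

(* uniformly Cauchy on compacta (every compact set lies in a closed disc) *)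
Definition loc_unif_cauchy (F : nat -> Cpx -> Csph) : Prop :=
  forall R0 eps, 0 < eps -> exists N, forall m n, (N <= m)%nat -> (N <= n)%nat ->
    forall z, Cnorm z <= R0 -> rhoS (F m z) (F n z) < eps.

Definition loc_unif_conv (F : nat -> Cpx -> Csph) (g : Cpx -> Csph) : Prop :=
  forall R0 eps, 0 < eps -> exists N, forall n, (N <= n)%nat ->
    forall z, Cnorm z <= R0 -> rhoS (F n z) (g z) < eps.

Definition normal_fun (f : Cpx -> Csph) : Prop :=
  forall h : nat -> Cpx, exists phi : nat -> nat,
    (forall n, (phi n < phi (S n))%nat) /\
    loc_unif_cauchy (fun n => translate f (h (phi n))).

Definition N1 (f : Cpx -> Csph) : Prop :=
  normal_fun f /\
  forall (h : nat -> Cpx) (g : Cpx -> Csph),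
    loc_unif_conv (fun n => translate f (h n)) g ->
    ~ (exists a : Csph, forall z, g z = a).

Definition abslog_trunc (n : nat) (a : Csph) : R :=
  match a with
  | None => INR n
  | Some z =>
      if Req_EM_T (Cnorm z) 0 then INR n else Rmin (Rabs (ln (Cnorm z))) (INR n)
  end.

Definition circ (c : Cpx) (r t : R) : Cpx := (fst c + r * cos t, snd c + r * sin t).

(* Main.v *)
Require Import Defs.
From Stdlib Require Import Reals Lra Lia Psatz ClassicalEpsilon Classical.
From Coquelicot Require Import Coquelicot.
(* After Coquelicot, whose [Forall] would otherwise hide the one on lists. *)
From Stdlib Require Import List.
Open Scope R_scope.

(** The bound is local: it suffices that there is an integer [K] such that, for every disc of
    radius [1 / (K + 1)] and every level [T >= K], at most [K] points of the disc can satisfy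
    [|log |f|| >= T] and be pairwise [K exp (- T / K)] apart. Covering the circle by O(r) arcs
    and summing over integer levels [T] then gives a convergent geometric series.

    If no such [K] exists, bad discs produce a Cauchy sequence of translates [F_n]. Near the
    centre, [F_n] or [1 / F_n] is holomorphic, bounded and uniformly Cauchy. By Cauchy's formula
    the divided differences at points close to [q] are close to the Taylor coefficient at [q];
    many separated points with small values make the divided difference small. So if some Taylor
    coefficient of positive order stays away from 0, separated small values are impossible, which
    contradicts the badness of the discs; and if all of them tend to 0, the oscillation of [F_n]
    tends to 0 near [q], hence by connectedness on every compact set, so that the translates
    converge to a constant, which [N1] excludes. *)

(** * Complex differentiability and contour integrals *)

(** The single integer [K] stands for every constant at once: radius, number of points, size and
    exponent of the separation. Hence the failure of all [K] yields one sequence of bad discs, and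
    large [K] defeats whatever order [k], bound [B] and radius [rho] belong to its limit. An
    exponent of the form [- T / K] is forced by zeros and poles: near one of order j, the set where
    |log |f|| >= T has diameter of order exp (- T / j), and j is not known in advance.

    Normality supplies Cauchy sequences only. No limit function is formed, except the constant one
    of the excluded case, and no zeros are counted: divided differences detect nonconstancy on the
    sequence itself. Those of positive order annihilate constants, so one estimate serves for values
    near 0 and for values near [G n q].

    The radius cancels because the number of arcs grows like r while the angle subtended by a given
    separation shrinks like 1 / r. Level sets may be irregular, so they are not measured but covered
    by intervals and majorized by smooth bumps. The constant does not depend on the truncation
    level, which is what makes the bound one for |log |f|| itself. *)

Definition Ccont (g : C -> C) (z : C) : Prop :=
  forall eps, 0 < eps -> exists del, 0 < del /\
    forall w, Cmod (w - z) < del -> Cmod (g w - g z) < eps.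

(* Caratheodory's form of complex differentiability: the difference quotient
   extends continuously, which makes products and inverses algebraic. *)
Definition Cdiff (g : C -> C) (z : C) : Prop :=
  exists (phi : C -> C) (del : R), 0 < del /\ Ccont phi z /\
    forall w, Cmod (w - z) < del -> g w = (g z + phi w * (w - z))%C.

Lemma Cmod_sub_sym (z w : C) : Cmod (z - w) = Cmod (w - z).
Proof. rewrite <- Cmod_opp. f_equal. ring. Qed.

Lemma Cmod_triangle_sub (a b c : C) : Cmod (a - c) <= Cmod (a - b) + Cmod (b - c).
Proof.
replace (a - c)%C with ((a - b) + (b - c))%C by ring. apply Cmod_triangle.
Qed.

Lemma Cmod_sub_le (a b : C) : Cmod (a - b) <= Cmod a + Cmod b.
Proof. unfold Cminus. rewrite <- (Cmod_opp b). apply Cmod_triangle. Qed.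

Lemma Cmod_le_sub_add (a b : C) : Cmod a <= Cmod (a - b) + Cmod b.
Proof. replace a with ((a - b) + b)%C at 1 by ring. apply Cmod_triangle. Qed.

Lemma Cmod_neq0 (z : C) : 0 < Cmod z -> z <> 0%C.
Proof. apply Cmod_gt_0. Qed.

Lemma Csub_neq0 (z w : C) : z <> w -> (z - w)%C <> 0%C.
Proof.
intros H E. apply H. replace z with ((z - w) + w)%C by ring. rewrite E. ring.
Qed.

Lemma Cmod_self (z : C) : Cmod (z - z) = 0.
Proof. replace (z - z)%C with (0:C)%C by ring. apply Cmod_0. Qed.

Lemma Ccont_const (c z : C) : Ccont (fun _ => c) z.
Proof.
intros e He. exists 1. split; [lra|]. intros w _. rewrite Cmod_self. exact He.
Qed.

Lemma Ccont_id (z : C) : Ccont (fun w => w) z.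
Proof. intros e He. exists e. split; [exact He|]. intros w H. exact H. Qed.

Lemma Ccont_plus (g h : C -> C) (z : C) :
  Ccont g z -> Ccont h z -> Ccont (fun w => g w + h w)%C z.
Proof.
intros Hg Hh e He.
destruct (Hg (e / 2)) as [d1 [D1 P1]]; [lra|].
destruct (Hh (e / 2)) as [d2 [D2 P2]]; [lra|].
exists (Rmin d1 d2). split; [apply Rmin_pos; assumption|].
intros w Hw.
assert (H1 := Rmin_l d1 d2). assert (H2 := Rmin_r d1 d2).
assert (Q1 := P1 w ltac:(lra)). assert (Q2 := P2 w ltac:(lra)).
replace (g w + h w - (g z + h z))%C with ((g w - g z) + (h w - h z))%C by ring.
assert (T := Cmod_triangle (g w - g z) (h w - h z)). lra.
Qed.

Lemma Ccont_mult (g h : C -> C) (z : C) :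
  Ccont g z -> Ccont h z -> Ccont (fun w => g w * h w)%C z.
Proof.
intros Hg Hh e He.
set (A := Cmod (g z)). set (B := Cmod (h z)).
assert (HA : 0 <= A) by apply Cmod_ge_0. assert (HB : 0 <= B) by apply Cmod_ge_0.
assert (E1 : 0 < e / (2 * (B + 1))) by (apply Rdiv_lt_0_compat; lra).
assert (E2 : 0 < Rmin 1 (e / (2 * (A + 1)))).
{ apply Rmin_pos; [lra|]. apply Rdiv_lt_0_compat; lra. }
destruct (Hg _ E1) as [d1 [D1 P1]]. destruct (Hh _ E2) as [d2 [D2 P2]].
exists (Rmin d1 d2). split; [apply Rmin_pos; assumption|].
intros w Hw.
assert (H1 := Rmin_l d1 d2). assert (H2 := Rmin_r d1 d2).
assert (Q1 := P1 w ltac:(lra)). assert (Q2 := P2 w ltac:(lra)).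
assert (Q3 := Rmin_l 1 (e / (2 * (A + 1)))). assert (Q4 := Rmin_r 1 (e / (2 * (A + 1)))).
replace (g w * h w - g z * h z)%C with ((g w - g z) * h w + g z * (h w - h z))%C by ring.
apply Rle_lt_trans with (1 := Cmod_triangle _ _).
rewrite !Cmod_mult. fold A.
assert (T := Cmod_le_sub_add (h w) (h z)). fold B in T.
assert (X : Cmod (g w - g z) * Cmod (h w) < e / 2).
{ apply Rle_lt_trans with (Cmod (g w - g z) * (B + 1)).
  - apply Rmult_le_compat_l; [apply Cmod_ge_0|lra].
  - apply Rlt_le_trans with (e / (2 * (B + 1)) * (B + 1)).
    + apply Rmult_lt_compat_r; lra.
    + right. field. lra. }
assert (Y : A * Cmod (h w - h z) <= e / 2).
{ apply Rle_trans with (A * (e / (2 * (A + 1)))).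
  - apply Rmult_le_compat_l; lra.
  - apply Rle_trans with ((A + 1) * (e / (2 * (A + 1)))).
    + apply Rmult_le_compat_r; [|lra]. apply Rlt_le, Rdiv_lt_0_compat; lra.
    + right. field. lra. }
lra.
Qed.

Lemma Ccont_minus (g h : C -> C) (z : C) :
  Ccont g z -> Ccont h z -> Ccont (fun w => g w - h w)%C z.
Proof.
intros Hg Hh.
assert (H := Ccont_plus _ _ _ Hg (Ccont_mult _ _ _ (Ccont_const (-(1))%C z) Hh)).
intros e He. destruct (H e He) as [d [D P]]. exists d. split; [exact D|].
intros w Hw. specialize (P w Hw).
replace (g w - h w - (g z - h z))%C with (g w + - (1) * h w - (g z + - (1) * h z))%C by ring.
exact P.
Qed.

Lemma Ccont_lower_bound (h : C -> C) (z : C) : Ccont h z -> h z <> 0%C ->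
  exists del, 0 < del /\ forall w, Cmod (w - z) < del -> Cmod (h z) / 2 < Cmod (h w).
Proof.
intros Hh Hz. assert (B := proj1 (Cmod_gt_0 _) Hz).
destruct (Hh (Cmod (h z) / 2)) as [d [D P]]; [lra|].
exists d. split; [exact D|]. intros w Hw. specialize (P w Hw).
assert (T := Cmod_le_sub_add (h z) (h w)). rewrite Cmod_sub_sym in T. lra.
Qed.

Lemma Ccont_inv (h : C -> C) (z : C) :
  Ccont h z -> h z <> 0%C -> Ccont (fun w => / h w)%C z.
Proof.
intros Hh Hz e He. assert (B := proj1 (Cmod_gt_0 _) Hz).
destruct (Ccont_lower_bound h z Hh Hz) as [d1 [D1 P1]].
set (b := Cmod (h z)) in *.
destruct (Hh (e * (b * b / 2))) as [d2 [D2 P2]].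
{ apply Rmult_lt_0_compat; nra. }
exists (Rmin d1 d2). split; [apply Rmin_pos; assumption|].
intros w Hw.
assert (H1 := Rmin_l d1 d2). assert (H2 := Rmin_r d1 d2).
assert (Q1 := P1 w ltac:(lra)). assert (Q2 := P2 w ltac:(lra)).
assert (Hw0 : h w <> 0%C) by (apply Cmod_neq0; lra).
replace (/ h w - / h z)%C with ((h z - h w) / (h w * h z))%C by (field; split; assumption).
rewrite Cmod_div by (apply Cmult_neq_0; assumption).
rewrite Cmod_mult, Cmod_sub_sym. fold b.
apply Rmult_lt_reg_r with (Cmod (h w) * b); [nra|].
unfold Rdiv. rewrite Rmult_assoc, Rinv_l by nra. rewrite Rmult_1_r.
apply Rlt_le_trans with (1 := Q2). apply Rmult_le_compat_l; nra.
Qed.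

Lemma Cdiff_cont (g : C -> C) (z : C) : Cdiff g z -> Ccont g z.
Proof.
intros [phi [d [D [Hp P]]]] e He.
assert (H := Ccont_plus _ _ _ (Ccont_const (g z) z)
   (Ccont_mult _ _ _ Hp (Ccont_minus _ _ _ (Ccont_id z) (Ccont_const z z)))).
destruct (H e He) as [d2 [D2 P2]].
exists (Rmin d d2). split; [apply Rmin_pos; assumption|].
intros w Hw.
assert (H1 := Rmin_l d d2). assert (H2 := Rmin_r d d2).
specialize (P2 w ltac:(lra)). rewrite (P w) by lra.
replace (g z + phi w * (w - z) - g z)%C with
  (g z + phi w * (w - z) - (g z + phi z * (z - z)))%C by ring.
exact P2.
Qed.

Lemma Cdiff_shift (c z : C) : Cdiff (fun w => w - c)%C z.
Proof.
exists (fun _ => 1%C), 1. split; [lra|]. split; [apply Ccont_const|].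
intros w _. ring.
Qed.

Lemma Cdiff_mult (g h : C -> C) (z : C) :
  Cdiff g z -> Cdiff h z -> Cdiff (fun w => g w * h w)%C z.
Proof.
intros Hg Hh. assert (Ch := Cdiff_cont _ _ Hh).
destruct Hg as [p [d1 [D1 [Hp P]]]]. destruct Hh as [q [d2 [D2 [Hq Q]]]].
exists (fun w => p w * h w + g z * q w)%C, (Rmin d1 d2).
split; [apply Rmin_pos; assumption|]. split.
- apply Ccont_plus; apply Ccont_mult; auto. apply Ccont_const.
- intros w Hw. assert (H1 := Rmin_l d1 d2). assert (H2 := Rmin_r d1 d2).
  rewrite (P w) by lra. rewrite (Q w) by lra. ring.
Qed.

Lemma Cdiff_inv (h : C -> C) (z : C) :
  Cdiff h z -> h z <> 0%C -> Cdiff (fun w => / h w)%C z.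
Proof.
intros Hh Hz. assert (Ch := Cdiff_cont _ _ Hh).
destruct Hh as [q [d2 [D2 [Hq Q]]]].
destruct (Ccont_lower_bound h z Ch Hz) as [d1 [D1 P1]].
exists (fun w => (q w * / h w) * (- / h z))%C, (Rmin d1 d2).
split; [apply Rmin_pos; assumption|]. split.
- apply Ccont_mult; [apply Ccont_mult; auto; apply Ccont_inv; auto|apply Ccont_const].
- intros w Hw. assert (H1 := Rmin_l d1 d2). assert (H2 := Rmin_r d1 d2).
  assert (Hw0 : h w <> 0%C).
  { apply Cmod_neq0. specialize (P1 w ltac:(lra)). assert (B := Cmod_ge_0 (h z)). lra. }
  assert (E := Q w ltac:(lra)).
  replace (/ h w)%C with (/ h z - (h w - h z) * / h w * / h z)%C at 1 by (field; split; assumption).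
  rewrite E at 1. ring.
Qed.

Lemma Cdiff_ext_loc (g h : C -> C) (z : C) (d : R) : 0 < d ->
  (forall w, Cmod (w - z) < d -> g w = h w) -> Cdiff h z -> Cdiff g z.
Proof.
intros Hd E [p [d1 [D1 [Hp P]]]].
exists p, (Rmin d d1). split; [apply Rmin_pos; assumption|]. split; [exact Hp|].
intros w Hw. assert (H1 := Rmin_l d d1). assert (H2 := Rmin_r d d1).
rewrite (E w) by lra. rewrite (E z) by (rewrite Cmod_self; exact Hd). apply P. lra.
Qed.

(** The quotient, completed by the value [L] at [z], is continuous there by the hypothesis. This is
    the passage from the epsilon form used in [holo_on_disc]. *)
Lemma Cdiff_of_quotient (g : C -> C) (z L : C) :
  (forall eps, 0 < eps -> exists del, 0 < del /\
      forall w, 0 < Cmod (w - z) < del ->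
        Cmod (g w - g z - L * (w - z)) <= eps * Cmod (w - z)) ->
  Cdiff g z.
Proof.
intros H.
exists (fun w => if Ceq_dec w z then L else (g w - g z) / (w - z))%C, 1.
split; [lra|]. split.
- intros e He. destruct (H (e / 2)) as [d [D P]]; [lra|]. exists d. split; [exact D|].
  intros w Hw. destruct (Ceq_dec z z) as [_|N]; [|now elim N].
  destruct (Ceq_dec w z) as [_|N].
  + rewrite Cmod_self. exact He.
  + assert (N' := Csub_neq0 _ _ N). assert (B := proj1 (Cmod_gt_0 _) N').
    specialize (P w (conj B Hw)).
    replace ((g w - g z) / (w - z) - L)%C with ((g w - g z - L * (w - z)) / (w - z))%C
      by (field; exact N').
    rewrite Cmod_div by exact N'.
    apply Rle_lt_trans with (e / 2); [|lra].
    apply Rmult_le_reg_r with (1 := B). unfold Rdiv at 1.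
    rewrite Rmult_assoc, Rinv_l by lra. lra.
- intros w _. destruct (Ceq_dec w z) as [->|N].
  + ring.
  + field. apply Csub_neq0, N.
Qed.

(** * Integrals of complex functions of a real variable *)

Definition CInt (u : R -> C) (a b : R) : C :=
  (RInt (fun t => fst (u t)) a b, RInt (fun t => snd (u t)) a b).

Definition cont_on (u : R -> C) (a b : R) : Prop :=
  forall t, a <= t <= b ->
    continuous (fun s => fst (u s)) t /\ continuous (fun s => snd (u s)) t.

Lemma cont_on_ex_RInt (u : R -> C) (a b : R) : a <= b -> cont_on u a b ->
  ex_RInt (fun t => fst (u t)) a b /\ ex_RInt (fun t => snd (u t)) a b.
Proof.
intros Hab H. split; apply (ex_RInt_continuous (V := R_CompleteNormedModule));
  intros t; rewrite Rmin_left, Rmax_right by exact Hab; intros Ht; apply (H t Ht).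
Qed.

Lemma cont_on_sub (u : R -> C) (a b a' b' : R) :
  a <= a' -> b' <= b -> cont_on u a b -> cont_on u a' b'.
Proof. intros H1 H2 H t Ht. apply H. lra. Qed.

Lemma RInt_lin2 (f g : R -> R) (a b k l : R) : ex_RInt f a b -> ex_RInt g a b ->
  RInt (fun t => k * f t + l * g t) a b = k * RInt f a b + l * RInt g a b.
Proof.
intros Hf Hg. apply is_RInt_unique.
apply (is_RInt_plus (V := R_NormedModule)); apply (is_RInt_scal (V := R_NormedModule));
  apply (RInt_correct (V := R_CompleteNormedModule)); assumption.
Qed.

Lemma ex_RInt_lin2 (f g : R -> R) (a b k l : R) : ex_RInt f a b -> ex_RInt g a b ->
  ex_RInt (fun t => k * f t + l * g t) a b.
Proof.
intros Hf Hg.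
apply (ex_RInt_plus (V := R_NormedModule)); apply (ex_RInt_scal (V := R_NormedModule)); assumption.
Qed.

Lemma CInt_lin (u v : R -> C) (a b : R) (k l : C) : a <= b -> cont_on u a b -> cont_on v a b ->
  CInt (fun t => k * u t + l * v t)%C a b = (k * CInt u a b + l * CInt v a b)%C.
Proof.
intros Hab Hu Hv.
destruct (cont_on_ex_RInt _ _ _ Hab Hu) as [U1 U2].
destruct (cont_on_ex_RInt _ _ _ Hab Hv) as [V1 V2].
destruct k as [k1 k2], l as [l1 l2].
unfold CInt. apply injective_projections; simpl.
- rewrite (RInt_ext _ (fun t => 1 * (k1 * fst (u t) + (- k2) * snd (u t))
      + 1 * (l1 * fst (v t) + (- l2) * snd (v t)))) by (intros; simpl; ring).
  rewrite (RInt_lin2 (fun t => (k1 * fst (u t) + (- k2) * snd (u t))) (fun t => l1 * fst (v t) + (- l2) * snd (v t)));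
    try apply ex_RInt_lin2; auto.
  rewrite !RInt_lin2; auto. ring.
- rewrite (RInt_ext _ (fun t => 1 * (k1 * snd (u t) + k2 * fst (u t))
      + 1 * (l1 * snd (v t) + l2 * fst (v t)))) by (intros; simpl; ring).
  rewrite (RInt_lin2 (fun t => (k1 * snd (u t) + k2 * fst (u t))) (fun t => l1 * snd (v t) + l2 * fst (v t)));
    try apply ex_RInt_lin2; auto.
  rewrite !RInt_lin2; auto. ring.
Qed.

Lemma CInt_ext (u v : R -> C) (a b : R) : a <= b ->
  (forall t, a <= t <= b -> u t = v t) -> CInt u a b = CInt v a b.
Proof.
intros Hab H. unfold CInt. f_equal; apply RInt_ext; intros t;
  rewrite Rmin_left, Rmax_right by exact Hab; intros Ht; rewrite H by lra; reflexivity.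
Qed.

Lemma CInt_Chasles (u : R -> C) (a m b : R) : a <= m <= b -> cont_on u a b ->
  CInt u a b = (CInt u a m + CInt u m b)%C.
Proof.
intros Hm Hu.
destruct (cont_on_ex_RInt u a m ltac:(lra) (cont_on_sub u a b a m ltac:(lra) ltac:(lra) Hu)) as [U1 U2].
destruct (cont_on_ex_RInt u m b ltac:(lra) (cont_on_sub u a b m b ltac:(lra) ltac:(lra) Hu)) as [V1 V2].
unfold CInt. apply injective_projections; simpl; symmetry;
  apply (RInt_Chasles (V := R_CompleteNormedModule)); assumption.
Qed.

Lemma Cmod_le_abs (z : C) : Cmod z <= Rabs (fst z) + Rabs (snd z).
Proof.
replace z with (RtoC (fst z) + Ci * RtoC (snd z))%C at 1.
- apply Rle_trans with (1 := Cmod_triangle _ _). rewrite Cmod_mult, !Cmod_R, Cmod_Ci. lra.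
- destruct z as [x y]. apply injective_projections; simpl; ring.
Qed.

Lemma abs_fst_le_Cmod (z : C) : Rabs (fst z) <= Cmod z.
Proof. apply Rle_trans with (2 := Rmax_Cmod z). apply Rmax_l. Qed.

Lemma abs_snd_le_Cmod (z : C) : Rabs (snd z) <= Cmod z.
Proof. apply Rle_trans with (2 := Rmax_Cmod z). apply Rmax_r. Qed.

(** The factor 2 is the price of bounding real and imaginary parts separately; only the order of
    magnitude matters later. *)
Lemma CInt_bound (u : R -> C) (a b M : R) : a <= b -> cont_on u a b ->
  (forall t, a <= t <= b -> Cmod (u t) <= M) -> Cmod (CInt u a b) <= 2 * M * (b - a).
Proof.
intros Hab Hu HM. destruct (cont_on_ex_RInt _ _ _ Hab Hu) as [U1 U2].
apply Rle_trans with (1 := Cmod_le_abs _). simpl.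
assert (A1 : Rabs (RInt (fun t => fst (u t)) a b) <= (b - a) * M).
{ apply abs_RInt_le_const; auto. intros t Ht.
  apply Rle_trans with (2 := HM t Ht). apply abs_fst_le_Cmod. }
assert (A2 : Rabs (RInt (fun t => snd (u t)) a b) <= (b - a) * M).
{ apply abs_RInt_le_const; auto. intros t Ht.
  apply Rle_trans with (2 := HM t Ht). apply abs_snd_le_Cmod. }
lra.
Qed.

Lemma Ccont_path (g : C -> C) (z v : C) (t : R) :
  Ccont g (z + RtoC t * v)%C ->
  continuous (fun s => fst (g (z + RtoC s * v)%C)) t /\
  continuous (fun s => snd (g (z + RtoC s * v)%C)) t.
Proof.
intros H.
assert (K : forall pr : C -> R, (forall a b, Rabs (pr a - pr b) <= Cmod (a - b)) ->
   continuous (fun s => pr (g (z + RtoC s * v)%C)) t).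
{ intros pr Hpr P [e He].
  destruct (H e (cond_pos e)) as [d [D Q]].
  assert (V := Cmod_ge_0 v).
  assert (D' : 0 < d / (Cmod v + 1)) by (apply Rdiv_lt_0_compat; lra).
  exists (mkposreal _ D'). intros s Hs. apply He.
  change (Rabs (pr (g (z + RtoC s * v)%C) - pr (g (z + RtoC t * v)%C)) < e).
  apply Rle_lt_trans with (1 := Hpr _ _). apply Q.
  replace (z + s * v - (z + t * v))%C with (RtoC (s - t) * v)%C by (rewrite RtoC_minus; ring).
  rewrite Cmod_mult, Cmod_R.
  change (Rabs (s - t) < d / (Cmod v + 1)) in Hs.
  apply Rle_lt_trans with (Rabs (s - t) * (Cmod v + 1)).
  - apply Rmult_le_compat_l; [apply Rabs_pos|lra].
  - apply Rlt_le_trans with (d / (Cmod v + 1) * (Cmod v + 1)).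
    + apply Rmult_lt_compat_r; lra.
    + right. field. lra. }
split; apply K; intros a b.
- exact (abs_fst_le_Cmod (a - b)%C).
- exact (abs_snd_le_Cmod (a - b)%C).
Qed.

(** * Contour integrals over boundaries of rectangles *)

Lemma cont_on_horizontal (g : C -> C) (a b c : R) :
  (forall x, a <= x <= b -> Ccont g (x, c)) -> cont_on (fun x => g (x, c)) a b.
Proof.
intros H t Ht. specialize (H t Ht).
assert (E : forall s, ((0, c) + RtoC s * 1)%C = (s, c)).
{ intros s. apply injective_projections; simpl; ring. }
rewrite <- (E t) in H. destruct (Ccont_path g _ _ _ H) as [K1 K2].
split; [eapply continuous_ext; [|exact K1]|eapply continuous_ext; [|exact K2]];
  intros s; simpl; rewrite E; reflexivity.
Qed.

Lemma cont_on_vertical (g : C -> C) (a c d : R) :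
  (forall y, c <= y <= d -> Ccont g (a, y)) -> cont_on (fun y => g (a, y)) c d.
Proof.
intros H t Ht. specialize (H t Ht).
assert (E : forall s, ((a, 0) + RtoC s * Ci)%C = (a, s)).
{ intros s. apply injective_projections; simpl; ring. }
rewrite <- (E t) in H. destruct (Ccont_path g _ _ _ H) as [K1 K2].
split; [eapply continuous_ext; [|exact K1]|eapply continuous_ext; [|exact K2]];
  intros s; simpl; rewrite E; reflexivity.
Qed.

(** The integral of g dz taken counterclockwise: dz is dx on the horizontal sides and i dy on the
    vertical ones, and the signs come from the orientation. *)
Definition Bdry (g : C -> C) (a b c d : R) : C :=
  (CInt (fun x => g (x, c)) a b - CInt (fun x => g (x, d)) a b
   + Ci * (CInt (fun y => g (b, y)) c d - CInt (fun y => g (a, y)) c d))%C.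

Definition on_bdry (a b c d : R) (z : C) : Prop :=
  (a <= fst z <= b /\ (snd z = c \/ snd z = d)) \/
  (c <= snd z <= d /\ (fst z = a \/ fst z = b)).

Definition in_rect (a b c d : R) (z : C) : Prop := a <= fst z <= b /\ c <= snd z <= d.

Lemma on_bdry_in_rect (a b c d : R) (z : C) :
  a <= b -> c <= d -> on_bdry a b c d z -> in_rect a b c d z.
Proof. intros H1 H2 [[H3 [H4|H4]]|[H3 [H4|H4]]]; unfold in_rect; lra. Qed.

Lemma bdry_cont (g : C -> C) (a b c d : R) :
  (forall z, on_bdry a b c d z -> Ccont g z) ->
  cont_on (fun x => g (x, c)) a b /\ cont_on (fun x => g (x, d)) a b /\
  cont_on (fun y => g (b, y)) c d /\ cont_on (fun y => g (a, y)) c d.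
Proof.
intros H.
split; [|split; [|split]].
- apply cont_on_horizontal. intros x Hx. apply H. left. simpl. auto.
- apply cont_on_horizontal. intros x Hx. apply H. left. simpl. auto.
- apply cont_on_vertical. intros y Hy. apply H. right. simpl. auto.
- apply cont_on_vertical. intros y Hy. apply H. right. simpl. auto.
Qed.

Lemma Bdry_lin (g h : C -> C) (a b c d : R) (k l : C) : a <= b -> c <= d ->
  (forall z, on_bdry a b c d z -> Ccont g z) -> (forall z, on_bdry a b c d z -> Ccont h z) ->
  Bdry (fun z => k * g z + l * h z)%C a b c d = (k * Bdry g a b c d + l * Bdry h a b c d)%C.
Proof.
intros Hab Hcd Hg Hh.
destruct (bdry_cont g a b c d Hg) as [G1 [G2 [G3 G4]]].
destruct (bdry_cont h a b c d Hh) as [K1 [K2 [K3 K4]]].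
unfold Bdry.
rewrite (CInt_lin (fun x => g (x, c)) (fun x => h (x, c))) by assumption.
rewrite (CInt_lin (fun x => g (x, d)) (fun x => h (x, d))) by assumption.
rewrite (CInt_lin (fun x => g (b, x)) (fun x => h (b, x))) by assumption.
rewrite (CInt_lin (fun x => g (a, x)) (fun x => h (a, x))) by assumption.
ring.
Qed.

Lemma Bdry_ext (g h : C -> C) (a b c d : R) : a <= b -> c <= d ->
  (forall z, on_bdry a b c d z -> g z = h z) -> Bdry g a b c d = Bdry h a b c d.
Proof.
intros Hab Hcd H. unfold Bdry.
rewrite (CInt_ext (fun x => g (x, c)) (fun x => h (x, c)));
[rewrite (CInt_ext (fun x => g (x, d)) (fun x => h (x, d)));
[rewrite (CInt_ext (fun x => g (b, x)) (fun x => h (b, x)));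
[rewrite (CInt_ext (fun x => g (a, x)) (fun x => h (a, x)))|..]|..]|..];
  auto; intros; apply H; unfold on_bdry; simpl; auto.
Qed.

Lemma Bdry_bound (g : C -> C) (a b c d M : R) : a <= b -> c <= d ->
  (forall z, on_bdry a b c d z -> Ccont g z) -> (forall z, on_bdry a b c d z -> Cmod (g z) <= M) ->
  Cmod (Bdry g a b c d) <= 4 * M * (b - a) + 4 * M * (d - c).
Proof.
intros Hab Hcd Hg HM.
destruct (bdry_cont g a b c d Hg) as [G1 [G2 [G3 G4]]].
unfold Bdry.
assert (B1 := CInt_bound _ _ _ M Hab G1 ltac:(intros; apply HM; unfold on_bdry; simpl; auto)).
assert (B2 := CInt_bound _ _ _ M Hab G2 ltac:(intros; apply HM; unfold on_bdry; simpl; auto)).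
assert (B3 := CInt_bound _ _ _ M Hcd G3 ltac:(intros; apply HM; unfold on_bdry; simpl; auto)).
assert (B4 := CInt_bound _ _ _ M Hcd G4 ltac:(intros; apply HM; unfold on_bdry; simpl; auto)).
apply Rle_trans with (1 := Cmod_triangle _ _).
rewrite Cmod_mult, Cmod_Ci, Rmult_1_l.
assert (T1 := Cmod_sub_le (CInt (fun x => g (x, c)) a b) (CInt (fun x => g (x, d)) a b)).
assert (T2 := Cmod_sub_le (CInt (fun x => g (b, x)) c d) (CInt (fun x => g (a, x)) c d)).
lra.
Qed.

Lemma Bdry_split_h (g : C -> C) (a m b c d : R) : a <= m <= b -> c <= d ->
  (forall z, on_bdry a b c d z -> Ccont g z) ->
  Bdry g a b c d = (Bdry g a m c d + Bdry g m b c d)%C.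
Proof.
intros Hm Hcd Hg. destruct (bdry_cont g a b c d Hg) as [G1 [G2 [G3 G4]]].
unfold Bdry. rewrite (CInt_Chasles (fun x => g (x, c)) a m b) by assumption.
rewrite (CInt_Chasles (fun x => g (x, d)) a m b) by assumption. ring.
Qed.

Lemma Bdry_split_v (g : C -> C) (a b c m d : R) : a <= b -> c <= m <= d ->
  (forall z, on_bdry a b c d z -> Ccont g z) ->
  Bdry g a b c d = (Bdry g a b c m + Bdry g a b m d)%C.
Proof.
intros Hab Hm Hg. destruct (bdry_cont g a b c d Hg) as [G1 [G2 [G3 G4]]].
unfold Bdry. rewrite (CInt_Chasles (fun x => g (b, x)) c m d) by assumption.
rewrite (CInt_Chasles (fun x => g (a, x)) c m d) by assumption. ring.
Qed.

(** * Goursat's theorem and Cauchy's formula *)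

Lemma Bdry_const (k : C) (a b c d : R) : Bdry (fun _ => k) a b c d = 0%C.
Proof.
unfold Bdry. ring.
Qed.

Lemma Bdry_id (a b c d : R) : Bdry (fun z => z) a b c d = 0%C.
Proof.
unfold Bdry, CInt. simpl. rewrite !RInt_const.
apply injective_projections; simpl; unfold scal; simpl; unfold mult; simpl; ring.
Qed.

(** Used for Goursat's bisection, where each rectangle is only known to have some good quarter;
    [epsilon] selects one at every stage. *)
Lemma dependent_choice (X : Type) (P : nat -> X -> Prop) (Q : nat -> X -> X -> Prop) (x0 : X) :
  P 0%nat x0 -> (forall n x, P n x -> exists y, P (S n) y /\ Q n x y) ->
  exists u : nat -> X, forall n, P n (u n) /\ Q n (u n) (u (S n)).
Proof.
intros H0 HS.
set (nxt := fun n x => epsilon (inhabits x0) (fun y => P (S n) y /\ Q n x y)).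
assert (Hn : forall n x, P n x -> P (S n) (nxt n x) /\ Q n x (nxt n x)).
{ intros n x Hx. apply epsilon_spec, HS, Hx. }
set (u := fix u n := match n with O => x0 | S m => nxt m (u m) end).
assert (HP : forall n, P n (u n)).
{ induction n; [exact H0|]. apply (Hn n (u n) IHn). }
exists u. intros n. split; [apply HP|]. apply (Hn n (u n) (HP n)).
Qed.

Lemma nested_intervals (lo w : nat -> R) :
  (forall n, 0 <= w n) ->
  (forall n, lo n <= lo (S n) /\ lo (S n) + w (S n) <= lo n + w n) ->
  exists x, forall n, lo n <= x <= lo n + w n.
Proof.
intros Hw H.
assert (U : forall n k, lo n <= lo (n + k)%nat /\ lo (n + k)%nat + w (n + k)%nat <= lo n + w n).
{ intros n k. induction k.
  - rewrite Nat.add_0_r. lra.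
  - rewrite Nat.add_succ_r. assert (K := H (n + k)%nat). lra. }
assert (B : forall n m, lo m <= lo n + w n).
{ intros n m. destruct (Nat.le_ge_cases n m) as [L|L].
  - destruct (U n (m - n)%nat) as [_ U2]. replace (n + (m - n))%nat with m in U2 by lia.
    specialize (Hw m). lra.
  - destruct (U m (n - m)%nat) as [U1 _]. replace (m + (n - m))%nat with n in U1 by lia.
    specialize (Hw n). lra. }
destruct (completeness (fun x => exists n, x = lo n)) as [x [X1 X2]].
- exists (lo 0%nat + w 0%nat). intros y [n ->]. apply B.
- exists (lo 0%nat), 0%nat. reflexivity.
- exists x. intros n. split.
  + apply X1. exists n. reflexivity.
  + apply X2. intros y [m ->]. apply B.
Qed.

Lemma pow_half_lt (h eps : R) : 0 < eps -> exists n, h / 2 ^ n < eps.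
Proof.
intros He.
destruct (pow_lt_1_zero (/ 2) ltac:(rewrite Rabs_pos_eq; lra) (eps / (Rabs h + 1))) as [n Hn].
- apply Rdiv_lt_0_compat; [lra|]. assert (T := Rabs_pos h). lra.
- exists n. specialize (Hn n ltac:(lia)).
  rewrite Rabs_pos_eq in Hn by (apply pow_le; lra). rewrite pow_inv in Hn.
  assert (P : 0 < 2 ^ n) by (apply pow_lt; lra).
  assert (T := Rabs_pos h). assert (T2 := Rle_abs h).
  apply Rle_lt_trans with ((Rabs h + 1) * / 2 ^ n).
  + apply Rmult_le_compat_r; [left; apply Rinv_0_lt_compat, P|lra].
  + apply Rmult_lt_reg_l with (/ (Rabs h + 1)); [apply Rinv_0_lt_compat; lra|].
    rewrite <- Rmult_assoc, Rinv_l, Rmult_1_l by lra. unfold Rdiv in Hn. lra.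
Qed.

(** The contributions of the inner sides cancel, so the four quarter integrals add up to the whole
    and they cannot all be smaller than a fourth of it. *)
Lemma Bdry_quarter (g : C -> C) (a c h k : R) : 0 <= h -> 0 <= k ->
  (forall z, in_rect a (a + h) c (c + k) z -> Ccont g z) ->
  exists a' c', (a' = a \/ a' = a + h / 2) /\ (c' = c \/ c' = c + k / 2) /\
    Cmod (Bdry g a (a + h) c (c + k)) / 4 <= Cmod (Bdry g a' (a' + h / 2) c' (c' + k / 2)).
Proof.
intros Hh Hk Hg.
rewrite (Bdry_split_h g a (a + h / 2) (a + h) c (c + k)); [|lra|lra|].
2: { intros z Hz. apply Hg, on_bdry_in_rect; auto; lra. }
rewrite (Bdry_split_v g a (a + h / 2) c (c + k / 2) (c + k)); [|lra|lra|].
2: { intros z Hz. apply Hg. apply on_bdry_in_rect in Hz; [|lra|lra]. unfold in_rect in *; lra. }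
rewrite (Bdry_split_v g (a + h / 2) (a + h) c (c + k / 2) (c + k)); [|lra|lra|].
2: { intros z Hz. apply Hg. apply on_bdry_in_rect in Hz; [|lra|lra]. unfold in_rect in *; lra. }
set (p := Bdry g a (a + h / 2) c (c + k / 2)).
set (q := Bdry g a (a + h / 2) (c + k / 2) (c + k)).
set (r := Bdry g (a + h / 2) (a + h) c (c + k / 2)).
set (s := Bdry g (a + h / 2) (a + h) (c + k / 2) (c + k)).
set (t := Cmod (p + q + (r + s))).
assert (T : t <= (Cmod p + Cmod q) + (Cmod r + Cmod s)).
{ unfold t. assert (T1 := Cmod_triangle (p + q) (r + s)).
  assert (T2 := Cmod_triangle p q). assert (T3 := Cmod_triangle r s). lra. }
assert (Ea : a + h = a + h / 2 + h / 2) by lra.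
assert (Ec : c + k = c + k / 2 + k / 2) by lra.
destruct (Rle_dec (t / 4) (Cmod p)) as [G|G]; [exists a, c; auto|].
destruct (Rle_dec (t / 4) (Cmod q)) as [G2|G2].
{ exists a, (c + k / 2). rewrite <- Ec. auto. }
destruct (Rle_dec (t / 4) (Cmod r)) as [G3|G3].
{ exists (a + h / 2), c. rewrite <- Ea. auto. }
exists (a + h / 2), (c + k / 2). rewrite <- Ea, <- Ec. repeat split; auto. fold s. lra.
Qed.

Lemma Cmod_rect (z w : C) (a h c k : R) :
  in_rect a (a + h) c (c + k) z -> in_rect a (a + h) c (c + k) w -> Cmod (z - w) <= h + k.
Proof.
intros [Z1 Z2] [W1 W2]. apply Rle_trans with (1 := Cmod_le_abs _). simpl.
apply Rplus_le_compat; apply Rabs_le; lra.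
Qed.

(** After n bisections the integral is still at least [delta / 4 ^ n]. Differentiability at the
    common point of the rectangles makes it o(4^-n), because the affine part integrates to 0 and
    perimeter times diameter is of order 4^-n. *)
Lemma Goursat (g : C -> C) (a b c d : R) : a <= b -> c <= d ->
  (forall z, in_rect a b c d z -> Cdiff g z) -> Bdry g a b c d = 0%C.
Proof.
intros Hab Hcd Hg.
set (h := b - a). set (k := d - c).
assert (Eb : b = a + h) by (unfold h; ring). assert (Ed : d = c + k) by (unfold k; ring).
assert (Hh : 0 <= h) by (unfold h; lra). assert (Hk : 0 <= k) by (unfold k; lra).
clearbody h k. subst b d.
assert (P2 : forall n, 0 < 2 ^ n) by (intro; apply pow_lt; lra).
assert (S2 : forall x n, x / 2 ^ S n = x / 2 ^ n / 2) by (intros; simpl; field; apply Rgt_not_eq, P2).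
assert (D2 : forall x n, 0 <= x -> 0 <= x / 2 ^ n) by (intros; apply Rdiv_le_0_compat; auto).
set (delta := Cmod (Bdry g a (a + h) c (c + k))).
set (P := fun n (p : C) => a <= fst p /\ fst p + h / 2 ^ n <= a + h /\
   c <= snd p /\ snd p + k / 2 ^ n <= c + k /\
   delta / 4 ^ n <= Cmod (Bdry g (fst p) (fst p + h / 2 ^ n) (snd p) (snd p + k / 2 ^ n))).
set (Q := fun n (p q : C) => (fst p <= fst q /\ fst q + h / 2 ^ S n <= fst p + h / 2 ^ n) /\
   (snd p <= snd q /\ snd q + k / 2 ^ S n <= snd p + k / 2 ^ n)).
destruct (dependent_choice C P Q (a, c)) as [u Hu].
- unfold P; simpl. rewrite !Rdiv_1_r. unfold delta. repeat split; lra.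
- intros n p [H1 [H2 [H3 [H4 H5]]]].
  destruct (Bdry_quarter g (fst p) (snd p) (h / 2 ^ n) (k / 2 ^ n)) as [a' [c' [Ha [Hc HB]]]]; auto.
  { intros z Hz. apply Cdiff_cont, Hg. unfold in_rect in *; lra. }
  exists (a', c'). assert (A1 := D2 h n Hh). assert (A2 := D2 k n Hk).
  unfold P, Q. simpl fst; simpl snd. rewrite !S2.
  assert (E4 : delta / 4 ^ S n = delta / 4 ^ n / 4).
  { simpl. field. apply pow_nonzero. lra. }
  rewrite E4. repeat split; try (destruct Ha, Hc; subst; lra).
- destruct (nested_intervals (fun n => fst (u n)) (fun n => h / 2 ^ n)) as [x Hx]; auto.
  { intros n. apply (proj2 (Hu n)). }
  destruct (nested_intervals (fun n => snd (u n)) (fun n => k / 2 ^ n)) as [y Hy]; auto.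
  { intros n. apply (proj2 (Hu n)). }
  set (z0 := (x, y) : C).
  assert (Z0 : forall n, in_rect (fst (u n)) (fst (u n) + h / 2 ^ n) (snd (u n)) (snd (u n) + k / 2 ^ n) z0).
  { intros n. split; [apply Hx|apply Hy]. }
  destruct (Hg z0) as [phi [d0 [D0 [Hp HD]]]].
  { destruct (Hu 0%nat) as [[A1 [A2 [A3 [A4 _]]]] _]. destruct (Z0 0%nat) as [B1 B2].
    split; lra. }
  apply Cmod_eq_0. fold delta.
  apply Rle_antisym; [|apply Cmod_ge_0]. apply Rnot_lt_le. intros Hdel.
  (* The coefficient 8 exceeds the 4 of the final estimate [F3], which yields the contradiction; the
     summand 1 keeps the denominator positive for a degenerate rectangle. *)
  set (e := delta / (8 * (h + k) * (h + k) + 1)).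
  assert (Hq : 0 <= (h + k) * (h + k)) by (apply Rle_0_sqr).
  assert (He : 0 < e) by (apply Rdiv_lt_0_compat; lra).
  destruct (Hp e He) as [d1 [D1 HP1]].
  destruct (pow_half_lt (h + k) (Rmin d0 d1)) as [n Hn]; [apply Rmin_pos; assumption|].
  destruct (Hu n) as [[A1 [A2 [A3 [A4 A5]]]] _].
  set (a' := fst (u n)) in *. set (c' := snd (u n)) in *.
  set (h' := h / 2 ^ n) in *. set (k' := k / 2 ^ n) in *.
  assert (Hh' : 0 <= h') by (apply D2; auto). assert (Hk' : 0 <= k') by (apply D2; auto).
  assert (Ehk : (h + k) / 2 ^ n = h' + k') by (unfold h', k'; field; apply Rgt_not_eq, P2).
  rewrite Ehk in Hn.
  assert (M1 := Rmin_l d0 d1). assert (M2 := Rmin_r d0 d1).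
  assert (Hin : forall z, on_bdry a' (a' + h') c' (c' + k') z -> in_rect a' (a' + h') c' (c' + k') z).
  { intros z Hz. apply on_bdry_in_rect; auto; lra. }
  assert (Hgc : forall z, on_bdry a' (a' + h') c' (c' + k') z -> Ccont g z).
  { intros z Hz. apply Cdiff_cont, Hg. apply Hin in Hz. unfold in_rect in *; lra. }
  (* The first-order Taylor polynomial of [g] at [z0], spelled as nested two-term combinations so
     that [Bdry_lin] applies to it. *)
  set (aff := fun z : C => (g z0 * 1 + phi z0 * (1 * z + (- z0) * 1))%C).
  assert (Caff : forall z, Ccont aff z).
  { intros z. unfold aff. repeat first [apply Ccont_const|apply Ccont_id|apply Ccont_plus|apply Ccont_mult]. }
  assert (Baff : Bdry aff a' (a' + h') c' (c' + k') = 0%C).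
  { unfold aff. rewrite (Bdry_lin (fun _ => 1%C) (fun z => (1 * z + (- z0) * 1)%C)); try lra.
    - rewrite (Bdry_lin (fun z => z) (fun z => 1%C)); try lra;
        [|intros; apply Ccont_id|intros; apply Ccont_const].
      rewrite Bdry_id, Bdry_const. ring.
    - intros; apply Ccont_const.
    - intros. repeat first [apply Ccont_const|apply Ccont_id|apply Ccont_plus|apply Ccont_mult]. }
  assert (Bg : Bdry g a' (a' + h') c' (c' + k')
     = Bdry (fun z => 1 * g z + (- (1)) * aff z)%C a' (a' + h') c' (c' + k')).
  { rewrite Bdry_lin; auto; try lra. rewrite Baff. ring. }
  rewrite Bg in A5.
  assert (BB : Cmod (Bdry (fun z => 1 * g z + (- (1)) * aff z)%C a' (a' + h') c' (c' + k'))
     <= 4 * (e * (h' + k')) * (a' + h' - a') + 4 * (e * (h' + k')) * (c' + k' - c')).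
  { apply Bdry_bound; try lra.
    - intros z Hz. apply Ccont_plus; apply Ccont_mult; auto using Ccont_const.
    - intros z Hz. assert (Dz := Cmod_rect z z0 _ _ _ _ (Hin z Hz) (Z0 n)).
      rewrite (HD z) by (fold h' k' in Dz; lra). unfold aff.
      replace (1 * (g z0 + phi z * (z - z0)) + - (1) * (g z0 * 1 + phi z0 * (1 * z + - z0 * 1)))%C
        with ((phi z - phi z0) * (z - z0))%C by ring.
      rewrite Cmod_mult. apply Rmult_le_compat; try apply Cmod_ge_0; [|exact Dz].
      left. apply HP1. fold h' k' in Dz. lra. }
  assert (F : delta / 4 ^ n <= 4 * e * (h' + k') * (h' + k')) by lra.
  assert (F2 : 4 * e * (h' + k') * (h' + k') = 4 * e * (h + k) * (h + k) / 4 ^ n).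
  { rewrite <- Ehk. replace 4 with (2 * 2) at 3 by ring. rewrite Rpow_mult_distr. field.
    apply Rgt_not_eq, P2. }
  rewrite F2 in F.
  assert (P4 : 0 < 4 ^ n) by (apply pow_lt; lra).
  assert (F3 : delta <= 4 * e * (h + k) * (h + k)).
  { apply Rmult_le_reg_r with (/ 4 ^ n); [apply Rinv_0_lt_compat, P4|exact F]. }
  assert (F4 : e * (8 * (h + k) * (h + k) + 1) = delta) by (unfold e; field; lra).
  nra.
Qed.

(** * The Cauchy kernel and Cauchy's formula *)

Lemma RInt_odd_kernel (t : R) : 0 < t -> forall x, RInt (fun s => (s - x) / ((s - x) ^ 2 + t ^ 2)) (x - t) (x + t) = 0.
Proof.
intros Ht x. apply is_RInt_unique.
assert (Pos : forall s, 0 < (s - x) ^ 2 + t ^ 2).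
{ intros s. assert (0 <= (s - x) ^ 2) by apply pow2_ge_0. assert (0 < t ^ 2) by (apply pow_lt; lra). lra. }
replace 0 with (minus (/ 2 * ln ((x + t - x) ^ 2 + t ^ 2)) (/ 2 * ln ((x - t - x) ^ 2 + t ^ 2))).
- apply (is_RInt_derive (V := R_CompleteNormedModule) (fun s => / 2 * ln ((s - x) ^ 2 + t ^ 2))).
  + intros s _. auto_derive; [apply Pos|]. field. apply Rgt_not_eq, Pos.
  + intros s _. apply (ex_derive_continuous (V := R_NormedModule)). auto_derive. apply Rgt_not_eq, Pos.
- unfold minus, plus, opp; simpl.
  replace ((x + t - x) * ((x + t - x) * 1)) with ((x - t - x) * ((x - t - x) * 1)) by ring. ring.
Qed.

Lemma RInt_even_kernel (t : R) : 0 < t -> forall x, RInt (fun s => t / ((s - x) ^ 2 + t ^ 2)) (x - t) (x + t) = PI / 2.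
Proof.
intros Ht x. apply is_RInt_unique.
assert (Pos : forall s, 0 < (s - x) ^ 2 + t ^ 2).
{ intros s. assert (0 <= (s - x) ^ 2) by apply pow2_ge_0. assert (0 < t ^ 2) by (apply pow_lt; lra). lra. }
replace (PI / 2) with (minus (atan ((x + t - x) / t)) (atan ((x - t - x) / t))).
- apply (is_RInt_derive (V := R_CompleteNormedModule) (fun s => atan ((s - x) / t))).
  + intros s _. evar_last.
    * apply (is_derive_comp atan (fun s => (s - x) / t)); [apply is_derive_atan|].
      auto_derive; [trivial|reflexivity].
    * unfold scal; simpl; unfold mult; simpl. unfold Rsqr. field.
      specialize (Pos s). repeat split; try lra; try nra.
  + intros s _. apply (ex_derive_continuous (V := R_NormedModule)). auto_derive. apply Rgt_not_eq, Pos.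
- unfold minus, plus, opp; simpl.
  replace ((x + t - x) / t) with 1 by (field; lra).
  replace ((x - t - x) / t) with (- (1)) by (field; lra).
  rewrite atan_opp, atan_1. lra.
Qed.

Definition WC : C := (0, 2 * PI).

(** On a side at signed distance c from [z], the function 1 / (w - z) splits into the odd kernel,
    whose integral is 0, and the even kernel, whose integral is pi / 2 up to sign. With the
    orientation each of the four sides contributes i pi / 2. *)
Lemma Bdry_kernel (z : C) (t : R) : 0 < t ->
  Bdry (fun w => / (w - z))%C (fst z - t) (fst z + t) (snd z - t) (snd z + t) = WC.
Proof.
intros Ht. destruct z as [x y]. simpl fst; simpl snd.
assert (O := RInt_odd_kernel t Ht). assert (V := RInt_even_kernel t Ht).
assert (X : forall c, c = t \/ c = - t -> CInt (fun s => / (((s, y + c)%R : C) - ((x, y) : C)))%C (x - t) (x + t) = ((0, - (c / t) * (PI / 2)) : C)).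
{ intros c Hc. unfold CInt. apply injective_projections; simpl fst; simpl snd.
  - rewrite <- (O x). apply RInt_ext. intros s _. simpl. f_equal.
    destruct Hc; subst c; ring_simplify; f_equal; ring.
  - rewrite <- (V x). rewrite <- (RInt_scal (V := R_CompleteNormedModule)).
    + apply RInt_ext. intros s _. unfold scal; simpl; unfold mult; simpl.
      assert (0 < (s - x) ^ 2 + t ^ 2).
      { assert (0 <= (s - x) ^ 2) by apply pow2_ge_0. assert (0 < t ^ 2) by (apply pow_lt; lra). lra. }
      destruct Hc; subst c; field; repeat split; try lra; simpl in *; nra.
    + apply (ex_RInt_continuous (V := R_CompleteNormedModule)). intros s _.
      apply (ex_derive_continuous (V := R_NormedModule)). auto_derive.
      assert (0 <= (s - x) ^ 2) by apply pow2_ge_0. assert (0 < t ^ 2) by (apply pow_lt; lra). simpl in *; lra. }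
assert (Y : forall c, c = t \/ c = - t -> CInt (fun s => / (((x + c, s)%R : C) - ((x, y) : C)))%C (y - t) (y + t) = (((c / t) * (PI / 2), 0) : C)).
{ intros c Hc. unfold CInt. apply injective_projections; simpl fst; simpl snd.
  - rewrite <- (V y). rewrite <- (RInt_scal (V := R_CompleteNormedModule)).
    + apply RInt_ext. intros s _. unfold scal; simpl; unfold mult; simpl.
      assert (0 < (s - y) ^ 2 + t ^ 2).
      { assert (0 <= (s - y) ^ 2) by apply pow2_ge_0. assert (0 < t ^ 2) by (apply pow_lt; lra). lra. }
      destruct Hc; subst c; field; repeat split; try lra; simpl in *; nra.
    + apply (ex_RInt_continuous (V := R_CompleteNormedModule)). intros s _.
      apply (ex_derive_continuous (V := R_NormedModule)). auto_derive.
      assert (0 <= (s - y) ^ 2) by apply pow2_ge_0. assert (0 < t ^ 2) by (apply pow_lt; lra). simpl in *; lra.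
  - transitivity ((-1) * 0); [|ring]. rewrite <- (O y). rewrite <- (RInt_scal (V := R_CompleteNormedModule)).
    + apply RInt_ext. intros s _. unfold scal; simpl; unfold mult; simpl.
      assert (0 < (s - y) ^ 2 + t ^ 2).
      { assert (0 <= (s - y) ^ 2) by apply pow2_ge_0. assert (0 < t ^ 2) by (apply pow_lt; lra). lra. }
      destruct Hc; subst c; field; repeat split; try lra; simpl in *; nra.
    + apply (ex_RInt_continuous (V := R_CompleteNormedModule)). intros s _.
      apply (ex_derive_continuous (V := R_NormedModule)). auto_derive.
      assert (0 <= (s - y) ^ 2) by apply pow2_ge_0. assert (0 < t ^ 2) by (apply pow_lt; lra). simpl in *; lra. }
unfold Bdry.
assert (X1 := X t (or_introl eq_refl)). assert (X2 := X (- t) (or_intror eq_refl)).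
assert (Y1 := Y t (or_introl eq_refl)). assert (Y2 := Y (- t) (or_intror eq_refl)).
change (y + - t) with (y - t) in X2. change (x + - t) with (x - t) in Y2.
rewrite X1, X2, Y1, Y2. unfold WC.
apply injective_projections; simpl; field; lra.
Qed.

(** Two vertical and two horizontal cuts leave the small square and four rectangles that avoid [z];
    [Goursat] kills the latter. *)
Lemma Bdry_shrink (u : C -> C) (a b c d t : R) (z : C) :
  0 < t -> a <= fst z - t -> fst z + t <= b -> c <= snd z - t -> snd z + t <= d ->
  (forall w, in_rect a b c d w -> w <> z -> Cdiff u w) ->
  Bdry u a b c d = Bdry u (fst z - t) (fst z + t) (snd z - t) (snd z + t).
Proof.
intros Ht H1 H2 H3 H4 Hu. destruct z as [x y]. simpl in *.
assert (N : forall w : C, fst w <> x \/ snd w <> y -> w <> (x, y)).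
{ intros w [E|E] E'; subst w; apply E; reflexivity. }
rewrite (Bdry_split_h u a (x - t) b c d); try lra.
2: { intros w Hw. apply Cdiff_cont, Hu; [apply on_bdry_in_rect; auto; lra|apply N].
  destruct Hw as [[A [B|B]]|[A [B|B]]]; try (right; lra); left; lra. }
rewrite (Bdry_split_h u (x - t) (x + t) b c d); try lra.
2: { intros w Hw. apply Cdiff_cont, Hu; [apply on_bdry_in_rect in Hw; try lra; unfold in_rect in *; lra|apply N].
  destruct Hw as [[A [B|B]]|[A [B|B]]]; try (right; lra); left; lra. }
rewrite (Bdry_split_v u (x - t) (x + t) c (y - t) d); try lra.
2: { intros w Hw. apply Cdiff_cont, Hu; [apply on_bdry_in_rect in Hw; try lra; unfold in_rect in *; lra|apply N].
  destruct Hw as [[A [B|B]]|[A [B|B]]]; try (right; lra); left; lra. }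
rewrite (Bdry_split_v u (x - t) (x + t) (y - t) (y + t) d); try lra.
2: { intros w Hw. apply Cdiff_cont, Hu; [apply on_bdry_in_rect in Hw; try lra; unfold in_rect in *; lra|apply N].
  destruct Hw as [[A [B|B]]|[A [B|B]]]; try (right; lra); left; lra. }
rewrite (Goursat u a (x - t) c d); try lra.
2: { intros w Hw. apply Hu; [unfold in_rect in *; lra|apply N; unfold in_rect in *; left; lra]. }
rewrite (Goursat u (x + t) b c d); try lra.
2: { intros w Hw. apply Hu; [unfold in_rect in *; lra|apply N; unfold in_rect in *; left; lra]. }
rewrite (Goursat u (x - t) (x + t) c (y - t)); try lra.
2: { intros w Hw. apply Hu; [unfold in_rect in *; lra|apply N; unfold in_rect in *; right; lra]. }
rewrite (Goursat u (x - t) (x + t) (y + t) d); try lra.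
2: { intros w Hw. apply Hu; [unfold in_rect in *; lra|apply N; unfold in_rect in *; right; lra]. }
ring.
Qed.

(** The contour shrinks to a small square about [z], where the integral of the kernel is known
    exactly and replacing [g w] by [g z] costs an arbitrarily small error. *)
Lemma Cauchy_formula (g : C -> C) (a b c d : R) (z : C) :
  a < fst z < b -> c < snd z < d ->
  (forall w, in_rect a b c d w -> Cdiff g w) ->
  Bdry (fun w => g w * / (w - z))%C a b c d = (WC * g z)%C.
Proof.
intros Hx Hy Hg.
assert (Hker : forall w, w <> z -> Cdiff (fun v => / (v - z))%C w).
{ intros w Hw. apply (Cdiff_inv (fun v => v - z)%C); [apply Cdiff_shift|apply Csub_neq0, Hw]. }
set (u := fun w => (g w * / (w - z))%C).
assert (Hu : forall w, in_rect a b c d w -> w <> z -> Cdiff u w).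
{ intros w Hw Hz. apply Cdiff_mult; auto. }
assert (E : Cmod (Bdry u a b c d - WC * g z) = 0).
{ apply Rle_antisym; [|apply Cmod_ge_0]. apply Rnot_lt_le. intros Hp.
  set (D := Cmod (Bdry u a b c d - WC * g z)) in *.
  (* The integrand is at most D / (32 t) on a square of half-side t, and [Bdry_bound] multiplies
     this by 16 t; the outcome is the contradiction [D <= D / 2]. *)
  destruct (Cdiff_cont g z (Hg z ltac:(unfold in_rect; lra)) (D / 32)) as [d1 [D1 P1]]; [lra|].
  set (t := Rmin (d1 / 3) (Rmin (Rmin (fst z - a) (b - fst z)) (Rmin (snd z - c) (d - snd z)))).
  assert (Ht : 0 < t) by (unfold t; repeat apply Rmin_pos; lra).
  assert (T1 : t <= d1 / 3) by apply Rmin_l.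
  assert (T2 : t <= Rmin (Rmin (fst z - a) (b - fst z)) (Rmin (snd z - c) (d - snd z))) by apply Rmin_r.
  assert (T3 := Rmin_l (Rmin (fst z - a) (b - fst z)) (Rmin (snd z - c) (d - snd z))).
  assert (T4 := Rmin_r (Rmin (fst z - a) (b - fst z)) (Rmin (snd z - c) (d - snd z))).
  assert (T5 := Rmin_l (fst z - a) (b - fst z)). assert (T6 := Rmin_r (fst z - a) (b - fst z)).
  assert (T7 := Rmin_l (snd z - c) (d - snd z)). assert (T8 := Rmin_r (snd z - c) (d - snd z)).
  clearbody t.
  assert (S : Bdry u a b c d = Bdry u (fst z - t) (fst z + t) (snd z - t) (snd z + t)).
  { apply Bdry_shrink; auto; lra. }
  set (B := on_bdry (fst z - t) (fst z + t) (snd z - t) (snd z + t)).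
  assert (Bfar : forall w, B w -> t <= Cmod (w - z)).
  { intros w [[_ [Q|Q]]|[_ [Q|Q]]].
    - apply Rle_trans with (2 := abs_snd_le_Cmod _). simpl. rewrite Q.
      replace (snd z - t + - snd z) with (- t) by ring. rewrite Rabs_Ropp. apply Rle_abs.
    - apply Rle_trans with (2 := abs_snd_le_Cmod _). simpl. rewrite Q.
      replace (snd z + t + - snd z) with t by ring. apply Rle_abs.
    - apply Rle_trans with (2 := abs_fst_le_Cmod _). simpl. rewrite Q.
      replace (fst z - t + - fst z) with (- t) by ring. rewrite Rabs_Ropp. apply Rle_abs.
    - apply Rle_trans with (2 := abs_fst_le_Cmod _). simpl. rewrite Q.
      replace (fst z + t + - fst z) with t by ring. apply Rle_abs. }
  assert (Bne : forall w, B w -> w <> z).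
  { intros w Hw E. specialize (Bfar w Hw). rewrite E, Cmod_self in Bfar. lra. }
  assert (Bin : forall w, B w -> in_rect a b c d w /\ Cmod (w - z) < d1).
  { intros w Hw. apply on_bdry_in_rect in Hw; try lra. split.
    - unfold in_rect in *; lra.
    - apply Rle_lt_trans with (2 * t); [|lra].
      apply Rle_trans with (1 := Cmod_le_abs _). simpl. destruct Hw as [W1 W2].
      assert (Rabs (fst w + - fst z) <= t) by (apply Rabs_le; lra).
      assert (Rabs (snd w + - snd z) <= t) by (apply Rabs_le; lra). lra. }
  assert (Bu : forall w, B w -> Ccont u w).
  { intros w Hw. apply Cdiff_cont, Hu; [apply Bin, Hw|apply Bne, Hw]. }
  assert (Bk : forall w, B w -> Ccont (fun v => / (v - z))%C w).
  { intros w Hw. apply Cdiff_cont, Hker, Bne, Hw. }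
  assert (L := Bdry_lin u (fun v => / (v - z))%C (fst z - t) (fst z + t) (snd z - t) (snd z + t) 1 (- g z)
    ltac:(lra) ltac:(lra) Bu Bk).
  rewrite Bdry_kernel in L by exact Ht.
  assert (L2 : (Bdry u a b c d - WC * g z)%C = Bdry (fun z0 => (1 * u z0 + - g z * / (z0 - z))%C) (fst z - t) (fst z + t) (snd z - t) (snd z + t)).
  { rewrite L, S. ring. }
  assert (U : D <= 4 * (D / 32 / t) * (fst z + t - (fst z - t)) + 4 * (D / 32 / t) * (snd z + t - (snd z - t))).
  { unfold D at 1. rewrite L2. apply Bdry_bound; try lra.
    - intros w Hw. apply Ccont_plus; apply Ccont_mult; auto using Ccont_const.
    - intros w Hw. unfold u.
      replace (1 * (g w * / (w - z)) + - g z * / (w - z))%C with ((g w - g z) * / (w - z))%C by ring.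
      assert (F := Bfar w Hw). assert (Nz := Csub_neq0 _ _ (Bne w Hw)).
      rewrite Cmod_mult, Cmod_inv by exact Nz.
      apply Rmult_le_compat; [apply Cmod_ge_0| | |].
      + left. apply Rinv_0_lt_compat. lra.
      + left. apply P1, Bin, Hw.
      + apply Rinv_le_contravar; lra. }
  replace (4 * (D / 32 / t) * (fst z + t - (fst z - t)) + 4 * (D / 32 / t) * (snd z + t - (snd z - t)))
    with (D / 2) in U by (field; lra). lra. }
apply Cmod_eq_0 in E. replace (Bdry u a b c d) with ((Bdry u a b c d - WC * g z) + WC * g z)%C by ring.
rewrite E. ring.
Qed.

(** * Divided differences *)

Definition square (p : C) (s : R) (u : C -> C) : C :=
  Bdry u (fst p - s) (fst p + s) (snd p - s) (snd p + s).

Definition on_square (p : C) (s : R) (z : C) : Prop :=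
  on_bdry (fst p - s) (fst p + s) (snd p - s) (snd p + s) z.

Fixpoint kern (l : list C) (x : C) : C :=
  match l with
  | nil => 1%C
  | z :: l' => (/ (x - z) * kern l' x)%C
  end.

(* Up to the factor [WC] this is the divided difference of [G] at the points of [l];
   repeated points are allowed. *)
Definition divdiff (p : C) (s : R) (G : C -> C) (l : list C) : C :=
  square p s (fun x => (G x * kern l x)%C).

Definition holo (G : C -> C) (p : C) (d : R) : Prop :=
  forall w, Cmod (w - p) < d -> Cdiff G w.

(** With the radius s / 4, two near points are less than s / 2 apart and each is at least 3 s / 4
    away from the square. The ratio 2 / 3 of these distances is what makes the Newton expansion
    converge. *)
Definition near (p : C) (s : R) (z : C) : Prop := Cmod (z - p) < s / 4.

Lemma on_square_far (p : C) (s : R) (z : C) : 0 < s -> on_square p s z -> s <= Cmod (z - p).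
Proof.
intros Hs [[_ [Q|Q]]|[_ [Q|Q]]].
- apply Rle_trans with (2 := abs_snd_le_Cmod _). simpl. rewrite Q.
  replace (snd p - s + - snd p) with (- s) by ring. rewrite Rabs_Ropp. apply Rle_abs.
- apply Rle_trans with (2 := abs_snd_le_Cmod _). simpl. rewrite Q.
  replace (snd p + s + - snd p) with s by ring. apply Rle_abs.
- apply Rle_trans with (2 := abs_fst_le_Cmod _). simpl. rewrite Q.
  replace (fst p - s + - fst p) with (- s) by ring. rewrite Rabs_Ropp. apply Rle_abs.
- apply Rle_trans with (2 := abs_fst_le_Cmod _). simpl. rewrite Q.
  replace (fst p + s + - fst p) with s by ring. apply Rle_abs.
Qed.

Lemma square_in_disc (p : C) (s : R) (z : C) : 0 < s ->
  in_rect (fst p - s) (fst p + s) (snd p - s) (snd p + s) z -> Cmod (z - p) < 2 * s.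
Proof.
intros Hs [H1 H2]. apply Rsqr_incrst_0; [|apply Cmod_ge_0|lra].
assert (E := Cmod2_alt (z - p)). unfold Re, Im in E. simpl in E. unfold Rsqr. nra.
Qed.

Lemma on_square_in_disc (p : C) (s : R) (z : C) : 0 < s ->
  on_square p s z -> Cmod (z - p) < 2 * s.
Proof. intros Hs H. apply square_in_disc; auto. apply on_bdry_in_rect; auto; lra. Qed.

Lemma near_far (p : C) (s : R) (z x : C) : 0 < s -> near p s z -> on_square p s x ->
  3 * s / 4 <= Cmod (x - z).
Proof.
intros Hs Hz Hx. apply on_square_far in Hx; auto. unfold near in Hz.
assert (T := Cmod_triangle_sub x z p). lra.
Qed.

Lemma near_sub_neq0 (p : C) (s : R) (z x : C) : 0 < s -> near p s z -> on_square p s x ->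
  (x - z)%C <> 0%C.
Proof. intros Hs Hz Hx. apply Cmod_neq0. assert (T := near_far p s z x Hs Hz Hx). lra. Qed.

Lemma near_inv_bound (p : C) (s : R) (z x : C) : 0 < s -> near p s z -> on_square p s x ->
  Cmod (/ (x - z)) <= 4 / (3 * s).
Proof.
intros Hs Hz Hx. rewrite Cmod_inv by (eapply near_sub_neq0; eauto).
replace (4 / (3 * s)) with (/ (3 * s / 4)) by (field; lra).
apply Rinv_le_contravar; [lra|]. eapply near_far; eauto.
Qed.

Lemma kern_cont (p : C) (s : R) (l : list C) (x : C) : 0 < s -> Forall (near p s) l ->
  on_square p s x -> Ccont (kern l) x.
Proof.
intros Hs Hl Hx. induction Hl as [|z l Hz Hl IH]; simpl.
- apply Ccont_const.
- apply Ccont_mult; [|exact IH]. apply (Ccont_inv (fun v => v - z)%C).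
  + apply Ccont_minus; [apply Ccont_id|apply Ccont_const].
  + eapply near_sub_neq0; eauto.
Qed.

Lemma kern_bound (p : C) (s : R) (l : list C) (x : C) : 0 < s -> Forall (near p s) l ->
  on_square p s x -> Cmod (kern l x) <= (4 / (3 * s)) ^ length l.
Proof.
intros Hs Hl Hx. induction Hl as [|z l Hz Hl IH]; simpl.
- rewrite Cmod_1. lra.
- rewrite Cmod_mult. apply Rmult_le_compat; try apply Cmod_ge_0; auto.
  eapply near_inv_bound; eauto.
Qed.

Lemma square_bound (p : C) (s M : R) (u : C -> C) : 0 < s ->
  (forall x, on_square p s x -> Ccont u x) -> (forall x, on_square p s x -> Cmod (u x) <= M) ->
  Cmod (square p s u) <= 16 * s * M.
Proof.
intros Hs Hc HM. unfold square.
assert (B := Bdry_bound u (fst p - s) (fst p + s) (snd p - s) (snd p + s) M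
  ltac:(lra) ltac:(lra) Hc HM). lra.
Qed.

Lemma square_lin (p : C) (s : R) (u v : C -> C) (k l : C) : 0 < s ->
  (forall x, on_square p s x -> Ccont u x) -> (forall x, on_square p s x -> Ccont v x) ->
  square p s (fun x => k * u x + l * v x)%C = (k * square p s u + l * square p s v)%C.
Proof.
intros Hs Hu Hv. exact (Bdry_lin u v (fst p - s) (fst p + s) (snd p - s) (snd p + s) k l ltac:(lra) ltac:(lra) Hu Hv).
Qed.

Lemma square_ext (p : C) (s : R) (u v : C -> C) : 0 < s ->
  (forall x, on_square p s x -> u x = v x) -> square p s u = square p s v.
Proof.
intros Hs H.
exact (Bdry_ext u v (fst p - s) (fst p + s) (snd p - s) (snd p + s) ltac:(lra) ltac:(lra) H).
Qed.

Lemma divdiff_cont (p : C) (s : R) (G : C -> C) (l : list C) : 0 < s ->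
  holo G p (2 * s) -> Forall (near p s) l ->
  forall x, on_square p s x -> Ccont (fun y => (G y * kern l y)%C) x.
Proof.
intros Hs HG Hl x Hx. apply Ccont_mult.
- apply Cdiff_cont, HG, on_square_in_disc; auto.
- eapply kern_cont; eauto.
Qed.

Lemma divdiff_bound (p : C) (s M : R) (G : C -> C) (l : list C) : 0 < s ->
  holo G p (2 * s) -> Forall (near p s) l -> (forall x, on_square p s x -> Cmod (G x) <= M) ->
  Cmod (divdiff p s G l) <= 16 * s * (M * (4 / (3 * s)) ^ length l).
Proof.
intros Hs HG Hl HM. apply square_bound; auto.
- apply divdiff_cont; auto.
- intros x Hx. rewrite Cmod_mult. apply Rmult_le_compat; try apply Cmod_ge_0; auto.
  eapply kern_bound; eauto.
Qed.

Lemma divdiff_single (p : C) (s : R) (G : C -> C) (z : C) : 0 < s ->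
  holo G p (2 * s) -> near p s z -> divdiff p s G (z :: nil) = (WC * G z)%C.
Proof.
intros Hs HG Hz. unfold divdiff.
rewrite (square_ext p s _ (fun x => G x * / (x - z))%C Hs) by (intros; simpl; ring).
unfold near in Hz.
assert (Z1 := abs_fst_le_Cmod (z - p)). assert (Z2 := abs_snd_le_Cmod (z - p)). simpl in Z1, Z2.
assert (Y1 : Rabs (fst z + - fst p) < s) by lra. assert (Y2 : Rabs (snd z + - snd p) < s) by lra.
apply Rabs_def2 in Y1. apply Rabs_def2 in Y2.
refine (Cauchy_formula G (fst p - s) (fst p + s) (snd p - s) (snd p + s) z _ _ _); [lra|lra|].
intros w Hw. apply HG, square_in_disc; auto.
Qed.

(** Partial fractions: (z - w) / ((x - z)(x - w)) = 1 / (x - z) - 1 / (x - w). The factor is kept on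
    the left so that coinciding points are covered. *)
Lemma divdiff_rec (p : C) (s : R) (G : C -> C) (z w : C) (l : list C) : 0 < s ->
  holo G p (2 * s) -> near p s z -> near p s w -> Forall (near p s) l ->
  ((z - w) * divdiff p s G (z :: w :: l) = divdiff p s G (z :: l) - divdiff p s G (w :: l))%C.
Proof.
intros Hs HG Hz Hw Hl. unfold divdiff.
transitivity (square p s (fun x => 1 * (G x * kern (z :: l) x) + (- (1)) * (G x * kern (w :: l) x))%C).
(* The zero summand gives a scalar multiple the two-term shape of [square_lin]. *)
- transitivity (square p s (fun x => (z - w) * (G x * kern (z :: w :: l) x) + 0 * (G x * kern (z :: w :: l) x))%C).
  + rewrite (square_lin p s (fun x => G x * kern (z :: w :: l) x)%C (fun x => G x * kern (z :: w :: l) x)%C); auto;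
      [ring|..]; apply divdiff_cont; auto.
  + apply square_ext; auto. intros x Hx. simpl. field. split; eapply near_sub_neq0; eauto.
- rewrite (square_lin p s (fun x => G x * kern (z :: l) x)%C (fun x => G x * kern (w :: l) x)%C); auto;
    [ring|..]; apply divdiff_cont; auto.
Qed.

Lemma divdiff_sub_bound (p : C) (s e : R) (G H : C -> C) (l : list C) : 0 < s ->
  holo G p (2 * s) -> holo H p (2 * s) -> Forall (near p s) l ->
  (forall x, on_square p s x -> Cmod (G x - H x) <= e) ->
  Cmod (divdiff p s G l - divdiff p s H l) <= 16 * s * (e * (4 / (3 * s)) ^ length l).
Proof.
intros Hs HG HH Hl He. unfold divdiff.
replace (square p s (fun x => G x * kern l x) - square p s (fun x => H x * kern l x))%C
  with (square p s (fun x => 1 * (G x * kern l x) + (- (1)) * (H x * kern l x))%C).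
- apply square_bound; auto.
  + intros x Hx. apply Ccont_plus; apply Ccont_mult; try apply Ccont_const; apply (divdiff_cont p s); auto.
  + intros x Hx.
    replace (1 * (G x * kern l x) + - (1) * (H x * kern l x))%C with ((G x - H x) * kern l x)%C by ring.
    rewrite Cmod_mult. apply Rmult_le_compat; try apply Cmod_ge_0; auto. eapply kern_bound; eauto.
- rewrite (square_lin p s (fun x => G x * kern l x)%C (fun x => H x * kern l x)%C); auto;
    [ring|..]; apply divdiff_cont; auto.
Qed.

Definition separated (eta : R) (l : list C) : Prop :=
  ForallOrdPairs (fun a b => eta <= Cmod (a - b)) l.

Lemma Cmod_WC : Cmod WC = 2 * PI.
Proof.
replace WC with (RtoC (2 * PI) * Ci)%C.
- rewrite Cmod_mult, Cmod_Ci, Cmod_R, Rabs_pos_eq; [ring|]. assert (P := PI_RGT_0). lra.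
- unfold WC. apply injective_projections; simpl; ring.
Qed.

(** Each application of the recurrence subtracts two divided differences, which doubles the bound,
    and divides by a distance of at least [eta]. The constant [kap] cancels in the first
    subtraction, and 2 pi is the modulus of [WC]. *)
Lemma divdiff_separated (p : C) (s : R) (G : C -> C) (kap : C) (eps eta : R) (m : nat) : 0 < s ->
  holo G p (2 * s) -> 0 < eta -> forall l, Forall (near p s) l -> length l = S (S m) ->
  Forall (fun z => Cmod (G z - kap) <= eps) l -> separated eta l ->
  Cmod (divdiff p s G l) <= 2 ^ S m * (2 * PI) * eps / eta ^ S m.
Proof.
intros Hs HG Heta. assert (HPI := PI_RGT_0).
assert (K : forall z w l B, near p s z -> near p s w -> Forall (near p s) l -> eta <= Cmod (z - w) ->
   Cmod (divdiff p s G (z :: l) - divdiff p s G (w :: l)) <= 2 * B ->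
   Cmod (divdiff p s G (z :: w :: l)) <= 2 * B / eta).
{ intros z w l B Hz Hw Hl Hzw HB. rewrite <- divdiff_rec in HB by auto.
  rewrite Cmod_mult in HB. assert (P := Cmod_ge_0 (divdiff p s G (z :: w :: l))).
  apply Rmult_le_reg_r with eta; [exact Heta|]. unfold Rdiv. rewrite Rmult_assoc, Rinv_l by lra.
  apply Rle_trans with (2 := Rle_trans _ _ (2 * B * 1) HB ltac:(lra)).
  rewrite Rmult_comm. apply Rmult_le_compat_r; auto. }
induction m as [|m IH]; intros l Hn Hlen Hk Hsep.
- destruct l as [|z [|w [|]]]; simpl in Hlen; try discriminate.
  inversion Hn as [|? ? Hz Hn']; subst. inversion Hn' as [|? ? Hw _]; subst.
  inversion Hk as [|? ? Kz Hk']; subst. inversion Hk' as [|? ? Kw _]; subst.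
  inversion Hsep as [|? ? Sz _]; subst. inversion Sz; subst.
  replace (2 ^ 1 * (2 * PI) * eps / eta ^ 1) with (2 * (2 * PI * eps) / eta) by (field; lra).
  apply K; auto. rewrite !divdiff_single by auto.
  replace (WC * G z - WC * G w)%C with (WC * ((G z - kap) - (G w - kap)))%C by ring.
  rewrite Cmod_mult, Cmod_WC. assert (T := Cmod_sub_le (G z - kap) (G w - kap)).
  apply Rle_trans with (2 * PI * (2 * eps)); [|lra]. apply Rmult_le_compat_l; lra.
- destruct l as [|z [|w l]]; simpl in Hlen; try discriminate.
  inversion Hn as [|? ? Hz Hn']; subst. inversion Hn' as [|? ? Hw Hl]; subst.
  inversion Hk as [|? ? Kz Hk']; subst. inversion Hk' as [|? ? Kw Kl]; subst.
  inversion Hsep as [|? ? Sz Sw]; subst. inversion Sz; subst. inversion Sw; subst.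
  replace (2 ^ S (S m) * (2 * PI) * eps / eta ^ S (S m))
    with (2 * (2 ^ S m * (2 * PI) * eps / eta ^ S m) / eta).
  2: { simpl. field. split; [apply pow_nonzero|]; lra. }
  apply K; auto.
  assert (B1 : Cmod (divdiff p s G (z :: l)) <= 2 ^ S m * (2 * PI) * eps / eta ^ S m).
  { apply IH; auto; try (simpl; lia). constructor; auto. }
  assert (B2 : Cmod (divdiff p s G (w :: l)) <= 2 ^ S m * (2 * PI) * eps / eta ^ S m).
  { apply IH; auto; simpl; lia. }
  assert (T := Cmod_sub_le (divdiff p s G (z :: l)) (divdiff p s G (w :: l))). lra.
Qed.

Lemma Forall_repeat (X : Type) (P : X -> Prop) (x : X) (n : nat) : P x -> Forall P (repeat x n).
Proof. intros H. induction n; simpl; auto. Qed.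

(** Telescoping: the points are replaced by [q] one at a time, each replacement costing a factor
    [rho] and one further factor 4 / (3 s). *)
Lemma kern_perturb (p : C) (s rho : R) (q : C) (l : list C) (x : C) : 0 < s -> near p s q ->
  Forall (near p s) l -> Forall (fun z => Cmod (z - q) <= rho) l -> on_square p s x ->
  Cmod (kern l x - kern (repeat q (length l)) x)
    <= INR (length l) * rho * (4 / (3 * s)) ^ S (length l).
Proof.
intros Hs Hq Hl. set (b := 4 / (3 * s)).
assert (Hb : 0 < b) by (unfold b; apply Rdiv_lt_0_compat; lra).
induction Hl as [|z l Hz Hl IH]; intros Hr Hx.
- simpl. rewrite Cmod_self. lra.
- inversion Hr as [|? ? Rz Rl]; subst. specialize (IH Rl Hx).
  change (kern (z :: l) x) with (/ (x - z) * kern l x)%C.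
  change (kern (repeat q (length (z :: l))) x) with (/ (x - q) * kern (repeat q (length l)) x)%C.
  change (length (z :: l)) with (S (length l)). set (m := length l) in *.
  rewrite S_INR.
  assert (Nz := near_sub_neq0 _ _ _ _ Hs Hz Hx). assert (Nq := near_sub_neq0 _ _ _ _ Hs Hq Hx).
  replace (/ (x - z) * kern l x - / (x - q) * kern (repeat q m) x)%C
    with ((z - q) * (/ (x - z) * / (x - q)) * kern l x + / (x - q) * (kern l x - kern (repeat q m) x))%C
    by (field; split; assumption).
  apply Rle_trans with (1 := Cmod_triangle _ _). rewrite !Cmod_mult.
  assert (Bz := near_inv_bound _ _ _ _ Hs Hz Hx). assert (Bq := near_inv_bound _ _ _ _ Hs Hq Hx).
  assert (Bk := kern_bound p s l x Hs Hl Hx). fold b m in Bz, Bq, Bk.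
  assert (Pm : 0 < b ^ m) by (apply pow_lt; auto).
  assert (Rz0 := Rle_trans _ _ _ (Cmod_ge_0 _) Rz).
  assert (X1 : Cmod (z - q) * (Cmod (/ (x - z)) * Cmod (/ (x - q))) * Cmod (kern l x) <= rho * (b * b) * b ^ m).
  { apply Rmult_le_compat; auto; try apply Cmod_ge_0.
    - apply Rmult_le_pos; [apply Cmod_ge_0|apply Rmult_le_pos; apply Cmod_ge_0].
    - apply Rmult_le_compat; auto; try apply Cmod_ge_0; [apply Rmult_le_pos; apply Cmod_ge_0|].
      apply Rmult_le_compat; auto; apply Cmod_ge_0. }
  assert (X2 : Cmod (/ (x - q)) * Cmod (kern l x - kern (repeat q m) x) <= b * (INR m * rho * b ^ S m)).
  { apply Rmult_le_compat; auto; apply Cmod_ge_0. }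
  simpl pow in *. lra.
Qed.

Lemma divdiff_perturb (p : C) (s rho M : R) (G : C -> C) (q : C) (l : list C) : 0 < s ->
  holo G p (2 * s) -> near p s q -> Forall (near p s) l ->
  Forall (fun z => Cmod (z - q) <= rho) l ->
  (forall x, on_square p s x -> Cmod (G x) <= M) ->
  Cmod (divdiff p s G l - divdiff p s G (repeat q (length l)))
    <= 16 * s * (M * (INR (length l) * rho * (4 / (3 * s)) ^ S (length l))).
Proof.
intros Hs HG Hq Hl Hr HM. unfold divdiff.
assert (Hrep : Forall (near p s) (repeat q (length l))) by (apply Forall_repeat; auto).
set (l2 := repeat q (length l)) in *.
replace (square p s (fun x => G x * kern l x) - square p s (fun x => G x * kern l2 x))%C
  with (square p s (fun x => 1 * (G x * kern l x) + (- (1)) * (G x * kern l2 x))%C).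
- apply square_bound; auto.
  + intros x Hx. apply Ccont_plus; apply Ccont_mult; try apply Ccont_const; apply (divdiff_cont p s); auto.
  + intros x Hx.
    replace (1 * (G x * kern l x) + - (1) * (G x * kern l2 x))%C with (G x * (kern l x - kern l2 x))%C by ring.
    rewrite Cmod_mult. apply Rmult_le_compat; try apply Cmod_ge_0; auto.
    apply (kern_perturb p s); auto.
- rewrite (square_lin p s (fun x => G x * kern l x)%C (fun x => G x * kern l2 x)%C); auto;
    [ring|..]; apply divdiff_cont; auto.
Qed.

(** * Flat and regular points of Cauchy sequences of holomorphic functions *)

Definition tends0 (u : nat -> R) : Prop :=
  forall eps, 0 < eps -> exists N, forall n, (N <= n)%nat -> u n < eps.

(** The bound 4 is the one that [bounded_chart_seq] provides. *)
Definition holo_seq (G : nat -> C -> C) (p : C) (d : R) (N0 : nat) : Prop :=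
  (forall n, (N0 <= n)%nat -> holo (G n) p d) /\
  (forall n, (N0 <= n)%nat -> forall z, Cmod (z - p) < d -> Cmod (G n z) <= 4) /\
  (forall eps, 0 < eps -> exists N, forall m n, (N <= m)%nat -> (N <= n)%nat ->
     forall z, Cmod (z - p) < d -> Cmod (G m z - G n z) < eps).

(* Quantitative substitute for "the limit of [G] is not constant near [q]": small values of
   [G n - kap] cannot be taken at [k + 2] well separated points. *)
Definition regular_seq (G : nat -> C -> C) (q : C) : Prop :=
  exists (k : nat) (B rho : R) (N : nat), 0 < B /\ 0 < rho /\
    forall n, (N <= n)%nat -> forall kap eps eta l, 0 < eta -> length l = S (S k) ->
      Forall (fun z => Cmod (z - q) < rho) l -> separated eta l ->
      Forall (fun z => Cmod (G n z - kap) <= eps) l -> eta ^ S k <= B * eps.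

(** Newton's expansion at the repeated node [q] has a remainder bounded by a constant times (2 /
    3)^K, uniformly in n. Hence finitely many coefficients control the difference, and pointwise
    convergence of each to 0 suffices. *)
Lemma flat_of_coefficients (G : nat -> C -> C) (p : C) (s : R) (N0 : nat) (q z : C) : 0 < s ->
  holo_seq G p (2 * s) N0 -> near p s q -> near p s z ->
  (forall k, tends0 (fun n => Cmod (divdiff p s (G n) (repeat q (S (S k)))))) ->
  tends0 (fun n => Cmod (G n z - G n q)).
Proof.
intros Hs [H1 [H2 H3]] Hq Hz Hc.
set (b := 4 / (3 * s)). assert (Hb : 0 < b) by (unfold b; apply Rdiv_lt_0_compat; lra).
set (r := Cmod (z - q)). assert (Hr0 : 0 <= r) by apply Cmod_ge_0.
assert (Hr : r <= s / 2).
{ unfold r, near in *. assert (T := Cmod_triangle_sub z p q). rewrite (Cmod_sub_sym p q) in T. lra. }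
assert (Hrb : r * b <= 2 / 3).
{ apply Rle_trans with (s / 2 * b); [apply Rmult_le_compat_r; lra|]. unfold b. right. field. lra. }
set (A := fun n k => Cmod (divdiff p s (G n) (z :: repeat q k))).
assert (Hrep : forall k, Forall (near p s) (repeat q k)) by (intros; apply Forall_repeat; auto).
assert (Step : forall n k, (N0 <= n)%nat ->
   A n (S k) <= Cmod (divdiff p s (G n) (repeat q (S (S k)))) + r * A n (S (S k))).
{ intros n k Hn. unfold A, r. rewrite <- Cmod_mult.
  change (repeat q (S (S k))) with (q :: repeat q (S k)).
  rewrite divdiff_rec; auto.
  replace (divdiff p s (G n) (z :: repeat q (S k)))
    with (divdiff p s (G n) (q :: repeat q (S k)) +
     (divdiff p s (G n) (z :: repeat q (S k)) - divdiff p s (G n) (q :: repeat q (S k))))%C at 1 by ring.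
  apply Cmod_triangle. }
(* [A n 1] is expanded through K coefficients, all of which tend to 0; [r ^ K * A n (S K)] is the
   remainder. *)
assert (Iter : forall K eps, 0 < eps -> exists N, forall n, (N <= n)%nat -> (N0 <= n)%nat ->
   A n 1%nat <= r ^ K * A n (S K) + eps).
{ induction K as [|K IH]; intros eps He.
  - exists 0%nat. intros. simpl. lra.
  - destruct (IH (eps / 2)) as [Na HNa]; [lra|].
    assert (PK : 0 < r ^ K + 1) by (assert (T := pow_le r K Hr0); lra).
    destruct (Hc K (eps / 2 / (r ^ K + 1))) as [Nb HNb].
    { apply Rdiv_lt_0_compat; lra. }
    exists (max Na Nb). intros n Hn Hn0.
    specialize (HNa n ltac:(lia) Hn0). specialize (HNb n ltac:(lia)).
    assert (S1 := Step n K Hn0).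
    assert (T := pow_le r K Hr0).
    assert (S2 : r ^ K * A n (S K) <= r ^ K * (eps / 2 / (r ^ K + 1)) + r ^ S K * A n (S (S K))).
    { apply Rle_trans with (r ^ K * (eps / 2 / (r ^ K + 1) + r * A n (S (S K)))).
      - apply Rmult_le_compat_l; lra.
      - simpl. right. ring. }
    assert (S3 : r ^ K * (eps / 2 / (r ^ K + 1)) <= eps / 2).
    { apply Rle_trans with ((r ^ K + 1) * (eps / 2 / (r ^ K + 1))).
      - apply Rmult_le_compat_r; [|lra]. left. apply Rdiv_lt_0_compat; lra.
      - right. field. lra. }
    lra. }
intros eps He.
(* K is fixed before n, which the uniform bound on [G n] permits. The remainder and the coefficients
   each receive [eps / (2 * (r + 1))], which leaves room for the final factor r. *)
destruct (pow_lt_1_zero (2 / 3) ltac:(rewrite Rabs_pos_eq; lra) (eps / (2 * (r + 1) * (64 * s * b ^ 2)))) as [K HK].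
{ apply Rdiv_lt_0_compat; auto. assert (0 < b ^ 2) by (apply pow_lt; auto).
  assert (0 < s * b ^ 2) by (apply Rmult_lt_0_compat; auto). nra. }
specialize (HK K (le_n K)). rewrite Rabs_pos_eq in HK by (apply pow_le; lra).
assert (HC : 0 < 64 * s * b ^ 2).
{ assert (0 < b ^ 2) by (apply pow_lt; auto). nra. }
assert (HK2 : 64 * s * b ^ 2 * (2 / 3) ^ K < eps / (2 * (r + 1))).
{ apply Rlt_le_trans with (64 * s * b ^ 2 * (eps / (2 * (r + 1) * (64 * s * b ^ 2)))).
  - apply Rmult_lt_compat_l; auto.
  - right. field. split; [|split]; lra. }
destruct (Iter K (eps / (2 * (r + 1)))) as [N HN]; [apply Rdiv_lt_0_compat; lra|].
exists (max N N0). intros n Hn. specialize (HN n ltac:(lia) ltac:(lia)).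
assert (Hn0 : (N0 <= n)%nat) by lia.
assert (BA : A n (S K) <= 16 * s * (4 * b ^ S (S K))).
{ unfold A. apply Rle_trans with (1 := divdiff_bound p s 4 (G n) (z :: repeat q (S K)) Hs (H1 n Hn0)
     ltac:(constructor; auto) ltac:(intros; apply H2; auto; apply on_square_in_disc; auto)).
  simpl length. rewrite repeat_length. fold b. lra. }
assert (BB : r ^ K * A n (S K) <= 64 * s * b ^ 2 * (2 / 3) ^ K).
{ apply Rle_trans with (r ^ K * (16 * s * (4 * b ^ S (S K)))).
  - apply Rmult_le_compat_l; auto. apply pow_le; auto.
  - apply Rle_trans with (64 * s * b ^ 2 * (r * b) ^ K).
    + rewrite Rpow_mult_distr. simpl. right. ring.
    + apply Rmult_le_compat_l; [lra|]. apply pow_incr. split; [apply Rmult_le_pos; lra|auto]. }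
assert (R1 : divdiff p s (G n) (z :: q :: nil) = divdiff p s (G n) (z :: repeat q 1)) by reflexivity.
assert (R2 := divdiff_rec p s (G n) z q nil Hs (H1 n Hn0) Hz Hq (Forall_nil _)).
rewrite !divdiff_single in R2 by auto.
(* The first divided difference is recovered through Cauchy's formula at [z] and at [q]. *)
assert (R3 : r * A n 1%nat = 2 * PI * Cmod (G n z - G n q)).
{ unfold A, r. rewrite <- Cmod_WC, <- !Cmod_mult. simpl repeat. rewrite R2. f_equal. ring. }
assert (P3 := PI2_3_2). assert (P4 := Cmod_ge_0 (G n z - G n q)).
assert (F1 : Cmod (G n z - G n q) <= r * A n 1%nat) by (rewrite R3; unfold PI2 in P3; nra).
assert (F2 : A n 1%nat < eps / (r + 1)).
{ apply Rlt_le_trans with (eps / (2 * (r + 1)) + eps / (2 * (r + 1))); [lra|]. right. field. lra. }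
assert (F3 : r * A n 1%nat <= r * (eps / (r + 1))) by (apply Rmult_le_compat_l; lra).
assert (F4 : r * (eps / (r + 1)) = eps - eps / (r + 1)) by (field; lra).
assert (0 < eps / (r + 1)) by (apply Rdiv_lt_0_compat; lra). lra.
Qed.

(** The Cauchy property upgrades a lower bound at infinitely many indices to one at all large
    indices: a single small term would make the whole tail small. *)
Lemma eventually_away (u : nat -> C) :
  (forall eps, 0 < eps -> exists N, forall m n, (N <= m)%nat -> (N <= n)%nat -> Cmod (u m - u n) < eps) ->
  ~ tends0 (fun n => Cmod (u n)) ->
  exists a N, 0 < a /\ forall n, (N <= n)%nat -> a <= Cmod (u n).
Proof.
intros Hc Hn. apply not_all_ex_not in Hn. destruct Hn as [e He]. apply imply_to_and in He.
destruct He as [He Hn]. destruct (Hc (e / 2)) as [N HN]; [lra|].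
exists (e / 2), N. split; [lra|]. intros n Hn'.
apply NNPP. intros Hlt. apply Hn. exists N. intros m Hm.
specialize (HN m n Hm Hn'). assert (T := Cmod_le_sub_add (u m) (u n)). lra.
Qed.

(** The coefficient that does not tend to 0 is eventually at least some a > 0 in modulus, since the
    Cauchy property passes to divided differences. Divided differences at points close to [q] then
    exceed a / 2, whereas separated points with values near [kap] make them at most of order eps /
    eta^(k+1). *)
Lemma regular_of_coefficient (G : nat -> C -> C) (p : C) (s : R) (N0 : nat) (q : C) (k : nat) : 0 < s ->
  holo_seq G p (2 * s) N0 -> near p s q ->
  ~ tends0 (fun n => Cmod (divdiff p s (G n) (repeat q (S (S k))))) ->
  regular_seq G q.
Proof.
intros Hs [H1 [H2 H3]] Hq Hc. assert (HPI := PI_RGT_0).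
set (b := 4 / (3 * s)). assert (Hb : 0 < b) by (unfold b; apply Rdiv_lt_0_compat; lra).
set (m := S (S k)) in *.
assert (Hrep : Forall (near p s) (repeat q m)) by (apply Forall_repeat; auto).
assert (HC : 0 < 16 * s * b ^ m) by (assert (0 < b ^ m) by (apply pow_lt; auto); nra).
destruct (eventually_away (fun n => divdiff p s (G n) (repeat q m))) as [a [N [Ha HN]]]; auto.
{ intros eps He. destruct (H3 (eps / 2 / (16 * s * b ^ m))) as [N HN].
  { apply Rdiv_lt_0_compat; lra. }
  exists (max N N0). intros i j Hi Hj.
  apply Rle_lt_trans with (1 := divdiff_sub_bound p s (eps / 2 / (16 * s * b ^ m)) (G i) (G j) (repeat q m)
     Hs (H1 i ltac:(lia)) (H1 j ltac:(lia)) Hrep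
     ltac:(intros x Hx; left; apply HN; try lia; apply on_square_in_disc; auto)).
  rewrite repeat_length. fold b.
  replace (16 * s * (eps / 2 / (16 * s * b ^ m) * b ^ m)) with (eps / 2); [lra|].
  field. repeat split; try (apply pow_nonzero); lra. }
set (D := 64 * s * INR m * b ^ S m).
assert (HD : 0 < D).
{ unfold D. assert (0 < INR m) by (apply lt_0_INR; unfold m; lia).
  assert (0 < b ^ S m) by (apply pow_lt; auto).
  apply Rmult_lt_0_compat; auto. apply Rmult_lt_0_compat; auto. lra. }
(* The first entry keeps points near [q] also [near] the centre [p]; the second limits the cost of
   moving all points to [q] to a / 2. *)
set (rho := Rmin (s / 4 - Cmod (q - p)) (a / 2 / D)).
assert (Q1 := Rmin_l (s / 4 - Cmod (q - p)) (a / 2 / D)).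
assert (Q2 := Rmin_r (s / 4 - Cmod (q - p)) (a / 2 / D)). fold rho in Q1, Q2.
assert (Hrho : 0 < rho).
{ unfold near in Hq. apply Rmin_pos; [lra|]. apply Rdiv_lt_0_compat; lra. }
assert (P2 : 0 < 2 ^ S k) by (apply pow_lt; lra).
(* The value of [B] is read off from a / 2 <= 2^(k+1) 2 pi eps / eta^(k+1). *)
exists k, (2 ^ S k * (2 * PI) * (2 / a)), rho, (max N N0).
split. { apply Rmult_lt_0_compat; [apply Rmult_lt_0_compat; lra|apply Rdiv_lt_0_compat; lra]. }
split; [exact Hrho|].
intros n Hn kap eps eta l Heta Hlen Hl Hsep Hk.
assert (Hn0 : (N0 <= n)%nat) by lia.
assert (Hln : Forall (near p s) l).
{ eapply Forall_impl; [|exact Hl]. intros z Hz. simpl in Hz. unfold near.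
  assert (T := Cmod_triangle_sub z q p). lra. }
assert (S1 := divdiff_separated p s (G n) kap eps eta k Hs (H1 n Hn0) Heta l Hln Hlen Hk Hsep).
assert (S2 := divdiff_perturb p s rho 4 (G n) q l Hs (H1 n Hn0) Hq Hln
   ltac:(eapply Forall_impl; [|exact Hl]; intros z Hz; simpl in Hz |- *; lra)
   ltac:(intros; apply H2; auto; apply on_square_in_disc; auto)).
rewrite Hlen in S2. fold m b in S2.
assert (S3 : 16 * s * (4 * (INR m * rho * b ^ S m)) <= a / 2).
{ replace (16 * s * (4 * (INR m * rho * b ^ S m))) with (D * rho) by (unfold D; ring).
  apply Rle_trans with (D * (a / 2 / D)); [apply Rmult_le_compat_l; lra|]. right. field. lra. }
specialize (HN n ltac:(lia)). simpl in HN.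
assert (S4 := Cmod_le_sub_add (divdiff p s (G n) (repeat q m)) (divdiff p s (G n) l)).
rewrite Cmod_sub_sym in S4.
assert (HE : 0 < eta ^ S k) by (apply pow_lt; auto).
assert (S5 : a / 2 <= 2 ^ S k * (2 * PI) * eps / eta ^ S k) by (unfold m in *; simpl repeat in *; lra).
apply Rmult_le_compat_r with (r := eta ^ S k) in S5; [|lra].
unfold Rdiv in S5 at 2. rewrite Rmult_assoc, Rinv_l in S5 by lra.
apply Rmult_le_reg_l with (a / 2); [lra|].
replace (a / 2 * (2 ^ S k * (2 * PI) * (2 / a) * eps)) with (2 ^ S k * (2 * PI) * eps) by (field; lra).
lra.
Qed.

Lemma flat_or_regular (G : nat -> C -> C) (p : C) (s : R) (N0 : nat) (q : C) : 0 < s ->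
  holo_seq G p (2 * s) N0 -> near p s q ->
  (forall z, near p s z -> tends0 (fun n => Cmod (G n z - G n q))) \/ regular_seq G q.
Proof.
intros Hs HG Hq.
destruct (classic (forall k, tends0 (fun n => Cmod (divdiff p s (G n) (repeat q (S (S k))))))) as [H|H].
- left. intros z Hz. eapply flat_of_coefficients; eauto.
- right. apply not_all_ex_not in H. destruct H as [k Hk]. eapply regular_of_coefficient; eauto.
Qed.

(** Flatness makes [G n] nearly equal to [G n q] at k + 2 fixed, equally spaced points. Here [kap]
    is [G n q], which is why [regular_seq] lets [kap] vary with n. *)
Lemma regular_not_flat (G : nat -> C -> C) (q : C) (d : R) : 0 < d -> regular_seq G q ->
  (forall z, Cmod (z - q) < d -> tends0 (fun n => Cmod (G n z - G n q))) -> False.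
Proof.
intros Hd [k [B [rho [N [HB [Hrho H]]]]]] Hf.
(* The points are q + i tau for i = 0, ..., k + 1, so the last one still lies strictly within
   [Rmin rho d] of [q]. *)
set (tau := Rmin rho d / INR (S (S k))).
assert (HK : 0 < INR (S (S k))) by (apply lt_0_INR; lia).
assert (Hmin : 0 < Rmin rho d) by (apply Rmin_pos; auto).
assert (Htau : 0 < tau) by (apply Rdiv_lt_0_compat; auto).
set (pt := fun i : nat => (q + RtoC (INR i * tau))%C).
assert (Hpt : forall i j, (i < j)%nat -> tau <= Cmod (pt i - pt j)).
{ intros i j Hij. unfold pt.
  replace (q + RtoC (INR i * tau) - (q + RtoC (INR j * tau)))%C with (RtoC ((INR i - INR j) * tau)).
  2: { apply injective_projections; simpl; ring. }
  rewrite Cmod_R, Rabs_left1.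
  - apply le_INR in Hij. rewrite S_INR in Hij. nra.
  - apply lt_INR in Hij. nra. }
assert (Hin : forall i, (i < S (S k))%nat -> Cmod (pt i - q) < Rmin rho d).
{ intros i Hi. unfold pt. replace (q + (INR i * tau)%R - q)%C with (RtoC (INR i * tau)) by ring.
  rewrite Cmod_R, Rabs_pos_eq; [|apply Rmult_le_pos; [apply pos_INR|lra]].
  apply lt_INR in Hi. apply Rlt_le_trans with (INR (S (S k)) * tau).
  - apply Rmult_lt_compat_r; auto.
  - unfold tau. right. field. lra. }
set (l := fun n => map pt (seq 0 n)).
assert (Sep : separated tau (l (S (S k)))).
{ unfold l, separated. generalize (S (S k)) at 1. intros n. generalize 0%nat.
  induction n as [|n IH]; intros a; simpl; constructor; auto.
  apply Forall_forall. intros z Hz. apply in_map_iff in Hz. destruct Hz as [j [<- Hj]].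
  apply in_seq in Hj. apply Hpt. lia. }
set (eps := tau ^ S k / (2 * B)).
assert (HT : 0 < tau ^ S k) by (apply pow_lt; auto).
assert (Heps : 0 < eps) by (apply Rdiv_lt_0_compat; lra).
assert (Ev : forall n0, (n0 <= S (S k))%nat -> exists M, forall n, (M <= n)%nat ->
    Forall (fun z => Cmod (G n z - G n q) <= eps) (l n0)).
{ induction n0 as [|n0 IH]; intros Hn0.
  - exists 0%nat. intros. constructor.
  - destruct IH as [M HM]; [lia|].
    destruct (Hf (pt n0)) with (eps := eps) as [M' HM']; auto.
    { apply Rlt_le_trans with (1 := Hin n0 ltac:(lia)). apply Rmin_r. }
    exists (max M M'). intros n Hn. unfold l. rewrite seq_S, map_app. apply Forall_app. split.
    + apply HM. lia.
    + constructor; [|constructor]. left. apply HM'. lia. }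
destruct (Ev _ (le_n _)) as [M HM].
assert (F := H (max N M) ltac:(lia) (G (max N M) q) eps tau (l (S (S k))) Htau
  ltac:(unfold l; rewrite length_map, length_seq; reflexivity)
  ltac:(unfold l; apply Forall_forall; intros z Hz; apply in_map_iff in Hz; destruct Hz as [j [<- Hj]];
        apply in_seq in Hj; apply Rlt_le_trans with (1 := Hin j ltac:(lia)); apply Rmin_l)
  Sep (HM (max N M) ltac:(lia))).
replace (B * eps) with (tau ^ S k / 2) in F by (unfold eps; field; lra). lra.
Qed.

(** * The spherical metric and sequences of translates *)

Lemma Cnorm_Cmod (z : C) : Cnorm z = Cmod z.
Proof. unfold Cnorm, Cmod. f_equal. ring. Qed.

Lemma Cmod_sqr (z : C) : Cmod z ^ 2 = fst z ^ 2 + snd z ^ 2.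
Proof. rewrite Cmod2_alt. reflexivity. Qed.

Lemma one_plus_sqr_pos (z : C) : 0 < 1 + Cmod z ^ 2.
Proof. assert (T := pow2_ge_0 (Cmod z)). lra. Qed.

Lemma rhoS_fin (z w : Cpx) :
  rhoS (Some z) (Some w) = 2 * Cmod (z - w) / sqrt ((1 + Cmod z ^ 2) * (1 + Cmod w ^ 2)).
Proof. unfold rhoS. rewrite !Cnorm_Cmod. reflexivity. Qed.

Lemma rhoS_sym (a b : Csph) : rhoS a b = rhoS b a.
Proof.
destruct a as [z|], b as [w|]; auto. rewrite !rhoS_fin, Cmod_sub_sym, Rmult_comm with (r1 := 1 + Cmod z ^ 2).
reflexivity.
Qed.

(* Stereographic projection: [rhoS] is the Euclidean distance in R^3. *)
Definition stereo (a : Csph) : (R * R) * R :=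
  match a with
  | Some z => ((2 * fst z / (1 + Cmod z ^ 2), 2 * snd z / (1 + Cmod z ^ 2)),
               (Cmod z ^ 2 - 1) / (1 + Cmod z ^ 2))
  | None => ((0, 0), 1)
  end.

(** The product norm is the square root of the sum of squares, so iterating the product gives the
    Euclidean norm and not a maximum. *)
Definition R3 : NormedModule R_AbsRing :=
  prod_NormedModule R_AbsRing (prod_NormedModule R_AbsRing R_NormedModule R_NormedModule) R_NormedModule.

Lemma norm_R3 (x y z : R) : norm (((x, y), z) : R3) = sqrt (x ^ 2 + y ^ 2 + z ^ 2).
Proof.
change (norm (((x, y), z) : R3)) with
  (sqrt (sqrt (Rabs x ^ 2 + Rabs y ^ 2) ^ 2 + Rabs z ^ 2)).
f_equal. rewrite !pow2_abs, pow2_sqrt; [reflexivity|].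
assert (A := pow2_ge_0 x). assert (B := pow2_ge_0 y). lra.
Qed.

Lemma rhoS_stereo (a b : Csph) : rhoS a b = norm (minus (stereo a : R3) (stereo b : R3)).
Proof.
assert (Q : forall x y : R, 0 <= x -> x ^ 2 = y -> x = sqrt y).
{ intros x y Hx <-. symmetry. apply sqrt_pow2, Hx. }
assert (M : forall x y z x' y' z' : R,
  norm (minus (((x, y), z) : R3) (((x', y'), z') : R3)) = sqrt ((x - x') ^ 2 + (y - y') ^ 2 + (z - z') ^ 2)).
{ intros. rewrite <- norm_R3. reflexivity. }
destruct a as [z|], b as [w|]; unfold stereo; rewrite M; apply Q.
- rewrite rhoS_fin. assert (P1 := one_plus_sqr_pos z). assert (P2 := one_plus_sqr_pos w).
  apply Rdiv_le_0_compat; [assert (T := Cmod_ge_0 (z - w)); lra|].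
  apply sqrt_lt_R0, Rmult_lt_0_compat; auto.
- rewrite rhoS_fin. assert (P1 := one_plus_sqr_pos z). assert (P2 := one_plus_sqr_pos w).
  unfold Rdiv at 1. rewrite !Rpow_mult_distr, pow_inv, pow2_sqrt by nra.
  rewrite (Cmod_sqr (z - w)). rewrite !Cmod_sqr in *. destruct z as [x y], w as [x' y']. simpl in *.
  field. split; lra.
- unfold rhoS. rewrite Cnorm_Cmod. assert (P1 := one_plus_sqr_pos z).
  apply Rdiv_le_0_compat; [lra|]. apply sqrt_lt_R0; auto.
- unfold rhoS. rewrite Cnorm_Cmod. assert (P1 := one_plus_sqr_pos z).
  unfold Rdiv at 1. rewrite Rpow_mult_distr, pow_inv, pow2_sqrt by lra.
  rewrite !Cmod_sqr in *. field. lra.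
- unfold rhoS. rewrite Cnorm_Cmod. assert (P1 := one_plus_sqr_pos w).
  apply Rdiv_le_0_compat; [lra|]. apply sqrt_lt_R0; auto.
- unfold rhoS. rewrite Cnorm_Cmod. assert (P1 := one_plus_sqr_pos w).
  unfold Rdiv at 1. rewrite Rpow_mult_distr, pow_inv, pow2_sqrt by lra.
  rewrite !Cmod_sqr in *. field. lra.
- simpl. lra.
- simpl. ring.
Qed.

Lemma rhoS_triangle (a b c : Csph) : rhoS a c <= rhoS a b + rhoS b c.
Proof.
rewrite !rhoS_stereo.
replace (minus (stereo a : R3) (stereo c : R3)) with
  (plus (minus (stereo a : R3) (stereo b : R3)) (minus (stereo b : R3) (stereo c : R3))).
- apply norm_triangle.
- symmetry. apply minus_trans.
Qed.

Lemma rhoS_le_sub (z w : Cpx) : rhoS (Some z) (Some w) <= 2 * Cmod (z - w).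
Proof.
rewrite rhoS_fin. assert (P1 := pow2_ge_0 (Cmod z)). assert (P2 := pow2_ge_0 (Cmod w)).
assert (S : 1 <= sqrt ((1 + Cmod z ^ 2) * (1 + Cmod w ^ 2))).
{ rewrite <- sqrt_1 at 1. apply sqrt_le_1_alt. nra. }
assert (T := Cmod_ge_0 (z - w)).
apply Rmult_le_reg_r with (sqrt ((1 + Cmod z ^ 2) * (1 + Cmod w ^ 2))); [lra|].
unfold Rdiv. rewrite Rmult_assoc, Rinv_l by lra. nra.
Qed.

(** The denominator in [rhoS] is at most 17, and 17 / 2 < 9. *)
Lemma sub_le_rhoS (z w : Cpx) : Cmod z <= 4 -> Cmod w <= 4 ->
  Cmod (z - w) <= 9 * rhoS (Some z) (Some w).
Proof.
intros Hz Hw. rewrite rhoS_fin.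
assert (P1 := Cmod_ge_0 z). assert (P2 := Cmod_ge_0 w). assert (T := Cmod_ge_0 (z - w)).
assert (Q1 := one_plus_sqr_pos z). assert (Q2 := one_plus_sqr_pos w).
assert (S0 : 0 < sqrt ((1 + Cmod z ^ 2) * (1 + Cmod w ^ 2))).
{ apply sqrt_lt_R0, Rmult_lt_0_compat; auto. }
assert (S : sqrt ((1 + Cmod z ^ 2) * (1 + Cmod w ^ 2)) <= 17).
{ rewrite <- (sqrt_pow2 17) by lra. apply sqrt_le_1_alt.
  assert (1 + Cmod z ^ 2 <= 17) by nra. assert (1 + Cmod w ^ 2 <= 17) by nra.
  simpl pow at 3. rewrite Rmult_1_r. apply Rmult_le_compat; lra. }
set (S' := sqrt ((1 + Cmod z ^ 2) * (1 + Cmod w ^ 2))) in *.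
apply Rmult_le_reg_r with S'; auto.
replace (9 * (2 * Cmod (z - w) / S') * S') with (18 * Cmod (z - w)) by (field; lra).
nra.
Qed.

(** If |w| > 4, then |w - v| >= |w| / 2, while the two square roots are at most 2 |w| and 3; this
    gives a distance of at least 1 / 6. Infinity is even 2 / 3 away. *)
Lemma rhoS_bounded_chart (a : Csph) (v : Cpx) : Cmod v <= 2 -> rhoS a (Some v) < / 6 ->
  exists w, a = Some w /\ Cmod w <= 4.
Proof.
intros Hv H. assert (P := Cmod_ge_0 v). assert (Q := one_plus_sqr_pos v).
assert (S3 : sqrt (1 + Cmod v ^ 2) <= 3).
{ rewrite <- (sqrt_pow2 3) by lra. apply sqrt_le_1_alt. nra. }
assert (S0 : 0 < sqrt (1 + Cmod v ^ 2)) by (apply sqrt_lt_R0; auto).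
destruct a as [w|].
- exists w. split; auto. apply Rnot_lt_le. intros Hw.
  rewrite rhoS_fin in H. rewrite sqrt_mult in H by (left; apply one_plus_sqr_pos).
  assert (Qw := one_plus_sqr_pos w).
  assert (Sw : sqrt (1 + Cmod w ^ 2) <= 2 * Cmod w).
  { rewrite <- (sqrt_pow2 (2 * Cmod w)) by lra. apply sqrt_le_1_alt. nra. }
  assert (Sw0 : 0 < sqrt (1 + Cmod w ^ 2)) by (apply sqrt_lt_R0; auto).
  assert (T := Cmod_le_sub_add w v).
  set (A := sqrt (1 + Cmod w ^ 2)) in *. set (B := sqrt (1 + Cmod v ^ 2)) in *.
  apply Rmult_lt_compat_r with (r := A * B) in H; [|nra].
  replace (2 * Cmod (w - v) / (A * B) * (A * B)) with (2 * Cmod (w - v)) in H by (field; lra).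
  assert (A * B <= 2 * Cmod w * 3) by (apply Rmult_le_compat; lra). lra.
- exfalso. unfold rhoS in H. rewrite Cnorm_Cmod in H.
  apply Rmult_lt_compat_r with (r := sqrt (1 + Cmod v ^ 2)) in H; auto.
  replace (2 / sqrt (1 + Cmod v ^ 2) * sqrt (1 + Cmod v ^ 2)) with 2 in H by (field; lra). lra.
Qed.

(** * Inversion and charts on the sphere *)

Lemma Defs_Cinv (z : C) : Defs.Cinv z = (/ z)%C.
Proof.
unfold Defs.Cinv, Cinv. destruct z as [x y]. simpl. rewrite !Rmult_1_r. reflexivity.
Qed.

Lemma sinv_Some (z : C) : z <> 0%C -> sinv (@Some Cpx z) = @Some Cpx (/ z)%C.
Proof.
intros Hz. simpl. rewrite Cnorm_Cmod. destruct (Req_EM_T (Cmod z) 0) as [E|E].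
- elim Hz. apply Cmod_eq_0, E.
- rewrite Defs_Cinv. reflexivity.
Qed.

Lemma sinv_zero : sinv (@Some Cpx (RtoC 0)) = None.
Proof.
simpl. rewrite Cnorm_Cmod. destruct (Req_EM_T (Cmod 0) 0) as [E|E]; auto.
elim E. apply Cmod_0.
Qed.

Lemma sinv_invol (a : Csph) : sinv (sinv a) = a.
Proof.
destruct a as [z|].
- destruct (Ceq_dec z 0) as [->|N].
  + rewrite sinv_zero. reflexivity.
  + rewrite sinv_Some by auto. rewrite sinv_Some by (intros E; apply C1_nz; rewrite <- (Cinv_r z N), E; ring).
    f_equal. field. repeat split; auto; apply C1_nz.
- exact sinv_zero.
Qed.

(** On the sphere, z -> 1 / z is the half turn about the first coordinate axis, hence an
    isometry. *)
Lemma stereo_sinv (a : Csph) :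
  stereo (sinv a) = ((fst (fst (stereo a)), - snd (fst (stereo a))), - snd (stereo a)).
Proof.
destruct a as [z|].
- destruct (Ceq_dec z 0) as [->|N].
  + rewrite sinv_zero. unfold stereo. rewrite Cmod_0. simpl.
    apply injective_projections; [apply injective_projections|]; simpl; field.
  + rewrite sinv_Some by auto. unfold stereo. rewrite Cmod_inv by auto.
    assert (B := proj1 (Cmod_gt_0 _) N). assert (E := Cmod_sqr z).
    assert (F := one_plus_sqr_pos z).
    assert (G1 : fst (/ z)%C = fst z / Cmod z ^ 2) by (rewrite E; reflexivity).
    assert (G2 : snd (/ z)%C = - snd z / Cmod z ^ 2) by (rewrite E; reflexivity).
    rewrite G1, G2. simpl in *.
    apply injective_projections; [apply injective_projections|]; simpl; field; split; try lra; nra.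
- change (sinv None) with (@Some Cpx (RtoC 0)). unfold stereo. rewrite Cmod_0. simpl.
  apply injective_projections; [apply injective_projections|]; simpl; field.
Qed.

Lemma rhoS_sinv (a b : Csph) : rhoS (sinv a) (sinv b) = rhoS a b.
Proof.
rewrite !rhoS_stereo, !stereo_sinv.
destruct (stereo a) as [[x y] z], (stereo b) as [[x' y'] z']. simpl fst; simpl snd.
change (norm (((x - x', - y - - y'), - z - - z') : R3) = norm (((x - x', y - y'), z - z') : R3)).
rewrite !norm_R3. f_equal. ring.
Qed.

(** The boolean records which of f and 1 / f is used as the local chart, so that zeros and poles are
    treated alike. *)
Definition flip (b : bool) (a : Csph) : Csph := if b then sinv a else a.

Lemma flip_negb (b : bool) (a : Csph) : flip (negb b) a = sinv (flip b a).
Proof. destruct b; simpl; auto. symmetry. apply sinv_invol. Qed.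

Lemma flip_invol (b : bool) (a : Csph) : flip b (flip b a) = a.
Proof. destruct b; simpl; auto. apply sinv_invol. Qed.

Lemma rhoS_flip (b : bool) (x y : Csph) : rhoS (flip b x) (flip b y) = rhoS x y.
Proof. destruct b; simpl; auto. apply rhoS_sinv. Qed.

(** The default 0 at infinity is harmless, because values are read off only where the chart is known
    to be finite. *)
Definition finval (a : Csph) : C := match a with Some z => z | None => 0%C end.

Definition locally_meromorphic (f : C -> Csph) : Prop :=
  forall z0 : C, exists d, 0 < d /\ exists (g : C -> C) (b : bool),
    (forall w, Cmod (w - z0) < d -> Cdiff g w) /\
    (forall w, Cmod (w - z0) < d -> flip b (f w) = @Some Cpx (g w)).

Lemma meromorphic_locally (f : Cpx -> Csph) : meromorphic f -> locally_meromorphic f.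
Proof.
intros [H _] z0. destruct (H z0) as [d [Hd [g [Hg Hf]]]].
assert (D : forall w, Cmod (w - z0) < d -> Cdiff g w).
{ intros w Hw. assert (Hw' : in_disc z0 d w) by (unfold in_disc; rewrite Cnorm_Cmod; exact Hw).
  destruct (Hg w Hw') as [L HL]. apply (Cdiff_of_quotient g w L).
  intros e He. destruct (HL e He) as [del [Hdel P]]. exists del. split; auto.
  intros v Hv. specialize (P v). rewrite !Cnorm_Cmod in P. apply P. exact Hv. }
exists d. split; auto. exists g.
destruct Hf as [Hf|Hf]; [exists false|exists true]; split; auto;
  intros w Hw; apply Hf; unfold in_disc; rewrite Cnorm_Cmod; exact Hw.
Qed.

Lemma locally_meromorphic_translate (f : C -> Csph) (h : C) :
  locally_meromorphic f -> locally_meromorphic (translate f h).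
Proof.
intros H z0. destruct (H (Cadd z0 h)) as [d [Hd [g [b [Hg Hf]]]]].
assert (E : forall w : C, Cmod (Cadd w h - Cadd z0 h) = Cmod (w - z0)).
{ intros w. f_equal. apply injective_projections; simpl; ring. }
exists d. split; auto. exists (fun w => g (Cadd w h)), b. split.
- intros w Hw. rewrite <- E in Hw. destruct (Hg _ Hw) as [phi [del [D1 [D2 D3]]]].
  exists (fun v => phi (Cadd v h)), del. split; auto.
  assert (E' : forall v : C, (Cadd v h - Cadd w h)%C = (v - w)%C).
  { intros v. apply injective_projections; simpl; ring. }
  split.
  + intros e He. destruct (D2 e He) as [d2 [Hd2 P]]. exists d2. split; auto.
    intros v Hv. apply P. rewrite E'. exact Hv.
  + intros v Hv. rewrite (D3 (Cadd v h)); rewrite E'; auto.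
- intros w Hw. apply Hf. rewrite E. exact Hw.
Qed.

(** If the chart differs from the one in which f is given by [g], the function is 1 / g, and
    finiteness at [z] says that g does not vanish there. *)
Lemma finval_Cdiff (f : C -> Csph) (b : bool) (z : C) : locally_meromorphic f ->
  flip b (f z) <> None -> Cdiff (fun w => finval (flip b (f w))) z.
Proof.
intros H Hz. destruct (H z) as [d [Hd [g [b' [Hg Hf]]]]].
assert (Hz0 : Cmod (z - z) < d) by (rewrite Cmod_self; exact Hd).
destruct (Bool.bool_dec b b') as [<-|Hb].
- apply (Cdiff_ext_loc _ g z d); auto. intros w Hw. rewrite Hf; auto.
- assert (Eb : b = negb b') by (destruct b, b'; simpl; congruence). subst b.
  rewrite flip_negb, Hf in Hz by exact Hz0.
  assert (Ng : g z <> 0%C).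
  { intros E. rewrite E, sinv_zero in Hz. apply Hz. reflexivity. }
  destruct (Ccont_lower_bound g z (Cdiff_cont _ _ (Hg z Hz0)) Ng) as [d1 [D1 P1]].
  apply (Cdiff_ext_loc _ (fun w => / g w)%C z (Rmin d d1)).
  + apply Rmin_pos; auto.
  + intros w Hw. assert (H1 := Rmin_l d d1). assert (H2 := Rmin_r d d1).
    rewrite flip_negb, Hf by lra. specialize (P1 w ltac:(lra)).
    assert (T := Cmod_ge_0 (g z)).
    rewrite sinv_Some; auto. apply Cmod_neq0. lra.
  + apply Cdiff_inv; auto.
Qed.

(** One of the values g(p) and 1 / g(p) has modulus at most 1, and continuity at most doubles it
    nearby. *)
Lemma bounded_chart (f : C -> Csph) (p : C) : locally_meromorphic f ->
  exists (b : bool) (d : R), 0 < d /\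
    forall z, Cmod (z - p) < d -> exists v, flip b (f z) = Some v /\ Cmod v <= 2.
Proof.
intros H. destruct (H p) as [d [Hd [g [b [Hg Hf]]]]].
assert (Hp0 : Cmod (p - p) < d) by (rewrite Cmod_self; exact Hd).
assert (Cg := Cdiff_cont _ _ (Hg p Hp0)).
destruct (Rle_dec (Cmod (g p)) 1) as [L|L].
- destruct (Cg 1 ltac:(lra)) as [d1 [D1 P1]]. exists b, (Rmin d d1).
  split; [apply Rmin_pos; auto|]. intros z Hz.
  assert (H1 := Rmin_l d d1). assert (H2 := Rmin_r d d1).
  exists (g z). split; [apply Hf; lra|]. specialize (P1 z ltac:(lra)).
  assert (T := Cmod_le_sub_add (g z) (g p)). lra.
- apply Rnot_le_lt in L.
  destruct (Ccont_lower_bound g p Cg ltac:(apply Cmod_neq0; lra)) as [d1 [D1 P1]].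
  exists (negb b), (Rmin d d1). split; [apply Rmin_pos; auto|]. intros z Hz.
  assert (H1 := Rmin_l d d1). assert (H2 := Rmin_r d d1). specialize (P1 z ltac:(lra)).
  assert (N : g z <> 0%C) by (apply Cmod_neq0; lra).
  exists (/ g z)%C. rewrite flip_negb, Hf by lra. split; [apply sinv_Some, N|].
  rewrite Cmod_inv by exact N. replace 2 with (/ / 2) by field.
  apply Rinv_le_contravar; lra.
Qed.

(** The chart of one late term [F N] serves all later terms, since these stay within spherical
    distance 1 / 6 of it; the bound rises from 2 to 4. On that bounded range the spherical and
    Euclidean distances are comparable. *)
Lemma bounded_chart_seq (F : nat -> C -> Csph) (p : C) :
  (forall n, locally_meromorphic (F n)) -> loc_unif_cauchy F ->
  exists (b : bool) (s : R) (N : nat), 0 < s /\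
    (forall n, (N <= n)%nat -> forall z, Cmod (z - p) < 2 * s ->
       exists v, flip b (F n z) = Some v /\ Cmod v <= 4) /\
    holo_seq (fun n z => finval (flip b (F n z))) p (2 * s) N.
Proof.
intros Hm Hc. destruct (Hc (Cmod p + 1) (/ 6) ltac:(lra)) as [N HN].
destruct (bounded_chart (F N) p (Hm N)) as [b [d [Hd Hb]]].
(* The radius [2 * s] is at most [d], where the chart of [F N] is valid, and at most 1, which keeps
   the disc inside the ball on which the sequence was compared with [F N]. *)
set (s := Rmin (d / 2) (/ 2)).
assert (S1 := Rmin_l (d / 2) (/ 2)). assert (S2 := Rmin_r (d / 2) (/ 2)). fold s in S1, S2.
assert (Hs : 0 < s) by (apply Rmin_pos; lra).
assert (Hin : forall z, Cmod (z - p) < 2 * s -> Cnorm z <= Cmod p + 1).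
{ intros z Hz. rewrite Cnorm_Cmod. assert (T := Cmod_le_sub_add z p). lra. }
assert (Hv : forall n, (N <= n)%nat -> forall z, Cmod (z - p) < 2 * s ->
       exists v, flip b (F n z) = Some v /\ Cmod v <= 4).
{ intros n Hn z Hz. destruct (Hb z ltac:(lra)) as [v [Ev Bv]].
  apply rhoS_bounded_chart with v; auto. rewrite <- Ev, rhoS_flip.
  apply HN; auto. }
exists b, s, N. split; auto. split; auto. split; [|split].
- intros n Hn w Hw. apply finval_Cdiff; auto.
  destruct (Hv n Hn w Hw) as [v [Ev _]]. rewrite Ev. discriminate.
- intros n Hn z Hz. destruct (Hv n Hn z Hz) as [v [Ev Bv]]. rewrite Ev. exact Bv.
- intros e He. destruct (Hc (Cmod p + 1) (e / 9) ltac:(lra)) as [N' HN'].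
  exists (max N N'). intros m n Hm' Hn' z Hz.
  destruct (Hv m ltac:(lia) z Hz) as [v [Ev Bv]]. destruct (Hv n ltac:(lia) z Hz) as [w [Ew Bw]].
  specialize (HN' m n ltac:(lia) ltac:(lia) z (Hin z Hz)).
  rewrite <- (rhoS_flip b) in HN'. rewrite Ev, Ew in HN' |- *. simpl finval.
  assert (T := sub_le_rhoS v w Bv Bw). lra.
Qed.

(** * Propagation of asymptotic constancy *)

(** This replaces equality of the values of a limit function at [z] and [w], without forming that
    limit. *)
Definition asymp (F : nat -> C -> Csph) (z w : C) : Prop := tends0 (fun n => rhoS (F n z) (F n w)).

Lemma asymp_trans (F : nat -> C -> Csph) (x y z : C) : asymp F x y -> asymp F y z -> asymp F x z.
Proof.
intros H1 H2 e He. destruct (H1 (e / 2)) as [N1 P1]; [lra|]. destruct (H2 (e / 2)) as [N2 P2]; [lra|].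
exists (max N1 N2). intros n Hn. specialize (P1 n ltac:(lia)). specialize (P2 n ltac:(lia)).
assert (T := rhoS_triangle (F n x) (F n y) (F n z)). lra.
Qed.

Lemma asymp_sym (F : nat -> C -> Csph) (x y : C) : asymp F x y -> asymp F y x.
Proof.
intros H e He. destruct (H e He) as [N P]. exists N. intros n Hn. rewrite rhoS_sym. auto.
Qed.

(** A local identity theorem: flatness near [q] rules out regularity at [q], and the dichotomy then
    gives flatness on the whole disc. The radius depends on [p] alone, so [q] may be any point of
    the disc. *)
Lemma asymp_chart (F : nat -> C -> Csph) (p : C) :
  (forall n, locally_meromorphic (F n)) -> loc_unif_cauchy F ->
  exists del, 0 < del /\ forall q, Cmod (q - p) < del ->
    (exists eta, 0 < eta /\ forall z, Cmod (z - q) < eta -> asymp F z q) ->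
    forall z, Cmod (z - p) < del -> asymp F z q.
Proof.
intros Hm Hc. destruct (bounded_chart_seq F p Hm Hc) as [b [s [N [Hs [Hv HG]]]]].
exists (s / 4). split; [lra|]. intros q Hq [eta [Heta Hflat]] z Hz.
destruct (flat_or_regular _ p s N q Hs HG Hq) as [H|H].
- intros e He. destruct (H z Hz (e / 2)) as [N' HN']; [lra|].
  exists (max N N'). intros n Hn. specialize (HN' n ltac:(lia)). simpl in HN'.
  destruct (Hv n ltac:(lia) z ltac:(lra)) as [v [Ev Bv]].
  destruct (Hv n ltac:(lia) q ltac:(lra)) as [w [Ew Bw]].
  rewrite <- (rhoS_flip b). rewrite Ev, Ew in HN' |- *. simpl finval in HN'.
  assert (T := rhoS_le_sub v w). lra.
- exfalso. apply (regular_not_flat _ q (Rmin eta s)) in H; auto; [apply Rmin_pos; auto|].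
  intros w Hw e He. assert (R1 := Rmin_l eta s). assert (R2 := Rmin_r eta s).
  destruct (Hflat w ltac:(lra) (e / 9)) as [N' HN']; [lra|].
  exists (max N N'). intros n Hn. specialize (HN' n ltac:(lia)).
  assert (T0 := Cmod_triangle_sub w q p).
  destruct (Hv n ltac:(lia) w ltac:(lra)) as [v [Ev Bv]].
  destruct (Hv n ltac:(lia) q ltac:(lra)) as [v' [Ew Bw]].
  rewrite <- (rhoS_flip b) in HN'. rewrite Ev, Ew in HN' |- *. simpl finval.
  assert (T := sub_le_rhoS v v' Bv Bw). lra.
Qed.

(** Connectedness of the unit interval, for a property that near each point holds everywhere or
    nowhere; the supremum of the initial segments on which it holds must be 1. *)
Lemma interval_connected (P : R -> Prop) :
  (forall t, 0 <= t <= 1 -> exists del, 0 < del /\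
     ((exists t', 0 <= t' <= 1 /\ Rabs (t' - t) < del /\ P t') ->
      forall t', 0 <= t' <= 1 -> Rabs (t' - t) < del -> P t')) ->
  P 0 -> P 1.
Proof.
intros H H0.
set (E := fun t => 0 <= t <= 1 /\ forall t', 0 <= t' <= t -> P t').
assert (E0 : E 0).
{ split; [lra|]. intros t' Ht'. replace t' with 0 by lra. exact H0. }
destruct (completeness E) as [tau [U L]].
- exists 1. intros t [Ht _]. lra.
- exists 0. exact E0.
- assert (T0 : 0 <= tau) by (apply U, E0).
  assert (T1 : tau <= 1) by (apply L; intros t [Ht _]; lra).
  destruct (H tau (conj T0 T1)) as [del [Hd HP]].
  assert (Hex : exists t, E t /\ tau - del < t).
  { apply NNPP. intros N. assert (tau <= tau - del); [|lra]. apply L. intros t Ht.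
    apply Rnot_lt_le. intros Hlt. apply N. exists t. auto. }
  destruct Hex as [t [[Ht Pt] Htau]]. assert (Ht' : t <= tau) by (apply U; split; auto).
  assert (Q : forall t', 0 <= t' <= 1 -> Rabs (t' - tau) < del -> P t').
  { apply HP. exists t. split; auto. split; [apply Rabs_def1; lra|apply Pt; lra]. }
  set (x := Rmin 1 (tau + del / 2)).
  assert (X1 := Rmin_l 1 (tau + del / 2)). assert (X2 := Rmin_r 1 (tau + del / 2)). fold x in X1, X2.
  assert (Ex : E x).
  { split; [split; [apply Rmin_glb; lra|lra]|]. intros t' Ht''.
    destruct (Rle_dec t' t) as [Hl|Hl]; [apply Pt; lra|]. apply Q; [lra|]. apply Rabs_def1; lra. }
  assert (Hx : x <= tau) by (apply U, Ex).
  assert (x = 1).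
  { unfold x in Hx |- *. unfold Rmin in *. destruct (Rle_dec 1 (tau + del / 2)); lra. }
  subst. apply (proj2 Ex). lra.
Qed.

(** Connectedness is applied along the segment from 0 to [z]. The property carried along is flatness
    on a neighbourhood of the point, not merely at it, because [asymp_chart] starts from a
    neighbourhood. *)
Lemma asymp_propagates (F : nat -> C -> Csph) (eta : R) :
  (forall n, locally_meromorphic (F n)) -> loc_unif_cauchy F -> 0 < eta ->
  (forall z, Cmod (z - 0) < eta -> asymp F z 0%C) -> forall z, asymp F z 0%C.
Proof.
intros Hm Hc Heta H0 z.
set (P := fun t : R => exists e, 0 < e /\ forall w, Cmod (w - RtoC t * z) < e -> asymp F w 0%C).
assert (K : P 1).
{ apply interval_connected.
  - intros t Ht. destruct (asymp_chart F (RtoC t * z)%C Hm Hc) as [del [Hd HQ]].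
    assert (Z := Cmod_ge_0 z).
    assert (Hin : forall t', Rabs (t' - t) < del / (Cmod z + 1) -> Cmod (RtoC t' * z - RtoC t * z) < del).
    { intros t' Ht'. replace (t' * z - t * z)%C with (RtoC (t' - t) * z)%C by (rewrite RtoC_minus; ring).
      rewrite Cmod_mult, Cmod_R. apply Rle_lt_trans with (Rabs (t' - t) * (Cmod z + 1)).
      - apply Rmult_le_compat_l; [apply Rabs_pos|lra].
      - apply Rlt_le_trans with (del / (Cmod z + 1) * (Cmod z + 1)).
        + apply Rmult_lt_compat_r; lra.
        + right. field. lra. }
    exists (del / (Cmod z + 1)). split; [apply Rdiv_lt_0_compat; lra|].
    intros [t1 [_ [Ht1 [e [He P1]]]]] t2 _ Ht2.
    assert (A0 : asymp F (RtoC t1 * z)%C 0%C) by (apply P1; rewrite Cmod_self; exact He).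
    assert (A1 : forall w, Cmod (w - RtoC t * z) < del -> asymp F w (RtoC t1 * z)%C).
    { apply HQ; auto. exists e. split; auto. intros w Hw.
      apply asymp_trans with (RtoC 0); auto. apply asymp_sym, A0. }
    specialize (Hin t2 Ht2).
    exists (del - Cmod (RtoC t2 * z - RtoC t * z)). split; [lra|].
    intros w Hw. apply asymp_trans with (RtoC t1 * z)%C; auto. apply A1.
    assert (T := Cmod_triangle_sub w (RtoC t2 * z) (RtoC t * z)). lra.
  - exists eta. split; auto. intros w Hw. apply H0.
    replace (RtoC 0 * z)%C with (0%C : C) in Hw by ring. exact Hw. }
destruct K as [e [He P1]]. apply P1.
replace (z - RtoC 1 * z)%C with (0%C : C) by ring. rewrite Cmod_0. exact He.
Qed.

(** In a bounded chart the values form a Cauchy sequence of complex numbers; their limit is carried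
    back by the same [flip]. *)
Lemma Csph_limit_at (F : nat -> C -> Csph) (p : C) :
  (forall n, locally_meromorphic (F n)) -> loc_unif_cauchy F ->
  exists a, tends0 (fun n => rhoS (F n p) a).
Proof.
intros Hm Hc. destruct (bounded_chart_seq F p Hm Hc) as [b [s [N [Hs [Hv [_ [_ H3]]]]]]].
assert (Hp : Cmod (p - p) < 2 * s) by (rewrite Cmod_self; lra).
set (u := fun n => finval (flip b (F n p))).
assert (Cau : forall pr : C -> R, (forall z w, Rabs (pr z - pr w) <= Cmod (z - w)) ->
   exists l, forall e, 0 < e -> exists M, forall n, (M <= n)%nat -> Rabs (pr (u n) - l) < e).
{ intros pr Hpr.
  destruct (Rcomplete.R_complete (fun n => pr (u n))) as [l Hl].
  - intros e He. destruct (H3 e He) as [M HM]. exists M. intros i j Hi Hj.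
    apply Rle_lt_trans with (1 := Hpr _ _). apply HM; auto.
  - exists l. intros e He. destruct (Hl e He) as [M HM]. exists M. intros n Hn. apply HM. lia. }
destruct (Cau fst) as [l1 L1]; [intros z w; exact (abs_fst_le_Cmod (z - w)%C)|].
destruct (Cau snd) as [l2 L2]; [intros z w; exact (abs_snd_le_Cmod (z - w)%C)|].
exists (flip b (@Some Cpx (l1, l2))).
intros e He. destruct (L1 (e / 4)) as [M1 P1]; [lra|]. destruct (L2 (e / 4)) as [M2 P2]; [lra|].
exists (max N (max M1 M2)). intros n Hn. specialize (P1 n ltac:(lia)). specialize (P2 n ltac:(lia)).
destruct (Hv n ltac:(lia) p Hp) as [v [Ev Bv]].
rewrite <- (rhoS_flip b), flip_invol, Ev.
unfold u in P1, P2. rewrite Ev in P1, P2. simpl finval in P1, P2.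
assert (T := rhoS_le_sub v (l1, l2)). assert (T2 := Cmod_le_abs (v - (l1, l2))).
unfold Rminus in P1, P2. simpl in T2. lra.
Qed.

Lemma constant_limit (F : nat -> C -> Csph) :
  (forall n, locally_meromorphic (F n)) -> loc_unif_cauchy F -> (forall z, asymp F z 0%C) ->
  exists a, loc_unif_conv F (fun _ => a).
Proof.
intros Hm Hc Hf. destruct (Csph_limit_at F 0%C Hm Hc) as [a Ha]. exists a.
intros R0 e He. destruct (Hc R0 (e / 3)) as [N HN]; [lra|]. exists N. intros n Hn z Hz.
destruct (Hf z (e / 3)) as [M1 P1]; [lra|]. destruct (Ha (e / 3)) as [M2 P2]; [lra|].
set (m := max N (max M1 M2)).
specialize (HN n m Hn ltac:(unfold m; lia) z Hz).
specialize (P1 m ltac:(unfold m; lia)). specialize (P2 m ltac:(unfold m; lia)).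
assert (T1 := rhoS_triangle (F n z) (F m z) a).
assert (T2 := rhoS_triangle (F m z) (F m 0%C) a). simpl in *. lra.
Qed.

(** * Counting separated points where the logarithm is large *)

(** Zeros and poles belong to every level, as |log |f|| is infinite there; this makes the condition
    invariant under inversion. *)
Definition biglog (T : R) (a : Csph) : Prop :=
  match a with
  | None => True
  | Some z => Cmod z = 0 \/ T <= Rabs (ln (Cmod z))
  end.

Lemma biglog_sinv (T : R) (a : Csph) : biglog T a -> biglog T (sinv a).
Proof.
destruct a as [z|]; intros H.
- destruct (Ceq_dec z 0) as [->|N].
  + rewrite sinv_zero. exact I.
  + rewrite sinv_Some by auto. assert (B := proj1 (Cmod_gt_0 _) N). destruct H as [H|H]; [lra|].
    right. rewrite Cmod_inv by auto. rewrite ln_Rinv, Rabs_Ropp by auto. exact H.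
- left. exact Cmod_0.
Qed.

Lemma biglog_flip (T : R) (b : bool) (a : Csph) : biglog T a -> biglog T (flip b a).
Proof. destruct b; auto. apply biglog_sinv. Qed.

Lemma exp_2_gt_4 : 4 < exp 2.
Proof.
replace 2 with (1 + 1) by ring. rewrite exp_plus. assert (E := exp_ineq1 1 ltac:(lra)). nra.
Qed.

(** Since 4 < e^2 <= e^T, a logarithm of modulus at least T can only be negative in a bounded
    chart. *)
Lemma biglog_small (T : R) (v : Cpx) : 2 <= T -> Cmod v <= 4 -> biglog T (Some v) -> Cmod v <= exp (- T).
Proof.
intros HT Hv [H|H]; [rewrite H; left; apply exp_pos|].
destruct (Rle_lt_or_eq_dec 0 (Cmod v) (Cmod_ge_0 v)) as [P|P]; [|rewrite <- P; left; apply exp_pos].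
destruct (Rle_dec 0 (ln (Cmod v))) as [L|L].
- exfalso. rewrite Rabs_pos_eq in H by auto.
  assert (exp 2 <= Cmod v); [|assert (E := exp_2_gt_4); lra].
  rewrite <- (exp_ln (Cmod v)) by auto. destruct (Req_dec 2 (ln (Cmod v))) as [->|N]; [lra|].
  left. apply exp_increasing. lra.
- rewrite Rabs_left in H by lra. rewrite <- (exp_ln (Cmod v)) by auto.
  destruct (Req_dec (ln (Cmod v)) (- T)) as [->|N]; [lra|]. left. apply exp_increasing. lra.
Qed.

Lemma exp_pow (x : R) (n : nat) : exp x ^ n = exp (INR n * x).
Proof.
induction n as [|n IH].
- simpl. rewrite Rmult_0_l, exp_0. reflexivity.
- simpl pow. rewrite IH, S_INR, <- exp_plus. f_equal. ring.
Qed.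

Lemma separated_firstn (eta : R) (l : list C) (n : nat) : separated eta l -> separated eta (firstn n l).
Proof.
unfold separated. intros H. revert n. induction H as [|a l Ha Hl IH]; intros n.
- rewrite firstn_nil. constructor.
- destruct n; simpl; constructor; auto.
  rewrite Forall_forall in *. intros x Hx. apply Ha.
  rewrite <- (firstn_skipn n l). apply in_or_app. auto.
Qed.

Lemma separated_translate (eta : R) (w : C) (l : list C) :
  separated eta l -> separated eta (map (fun z => z - w)%C l).
Proof.
unfold separated. intros H. induction H as [|a l Ha Hl IH]; simpl; constructor; auto.
apply Forall_forall. intros x Hx. apply in_map_iff in Hx. destruct Hx as [y [<- Hy]].
rewrite Forall_forall in Ha. specialize (Ha y Hy).
replace (a - w - (y - w))%C with (a - y)%C by ring. exact Ha.
Qed.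

(** Bad discs for every K are translated to the origin. For their Cauchy subsequence, flatness at 0
    contradicts [N1], while regularity with constants k, B, rho contradicts badness as soon as K is
    large compared with them. *)
Lemma uniform_count (f : Cpx -> Csph) : meromorphic f -> N1 f ->
  exists K : nat, (1 <= K)%nat /\ forall (w : C) (T : R) (l : list C), INR K <= T ->
    Forall (fun z => Cmod (z - w) < / (INR K + 1)) l ->
    Forall (fun z => biglog T (f z)) l ->
    separated (INR K * exp (- T / INR K)) l -> (length l <= K)%nat.
Proof.
intros Hmer [Hnorm Hnc]. apply NNPP. intros Hno.
set (bad := fun (K : nat) (w : C) => exists (T : R) (l : list C), INR K <= T /\
    Forall (fun z => Cmod (z - w) < / (INR K + 1)) l /\
    Forall (fun z => biglog T (f z)) l /\
    separated (INR K * exp (- T / INR K)) l /\ (K < length l)%nat).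
assert (Hbad : forall K, exists w, bad (S K) w).
{ intros K. apply NNPP. intros N. apply Hno. exists (S K). split; [lia|].
  intros w T l H1 H2 H3 H4. apply Nat.nlt_ge. intros H5. apply N. exists w, T, l. auto. }
set (h := fun K => proj1_sig (constructive_indefinite_description _ (Hbad K))).
assert (Hh : forall K, bad (S K) (h K)).
{ intros K. unfold h. apply proj2_sig. }
destruct (Hnorm h) as [phi [Hphi Hc]].
assert (Hphin : forall n, (n <= phi n)%nat).
{ induction n; [lia|]. specialize (Hphi n). lia. }
set (F := fun n => translate f (h (phi n))) in *.
assert (Hm : forall n, locally_meromorphic (F n)).
{ intros n. apply locally_meromorphic_translate, meromorphic_locally, Hmer. }
destruct (bounded_chart_seq F 0%C Hm Hc) as [b [s [N [Hs [Hv HG]]]]].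
assert (Hnear : near 0%C s 0%C) by (unfold near; rewrite Cmod_self; lra).
destruct (flat_or_regular _ 0%C s N 0%C Hs HG Hnear) as [Hflat|Hreg].
- assert (H0 : forall z, Cmod (z - 0) < s / 4 -> asymp F z 0%C).
  { intros z Hz e He. destruct (Hflat z Hz (e / 2)) as [N' HN']; [lra|].
    exists (max N N'). intros n Hn. specialize (HN' n ltac:(lia)). simpl in HN'.
    destruct (Hv n ltac:(lia) z ltac:(lra)) as [v [Ev Bv]].
    destruct (Hv n ltac:(lia) 0%C ltac:(rewrite Cmod_self; lra)) as [w [Ew Bw]].
    rewrite <- (rhoS_flip b). rewrite Ev, Ew in HN' |- *. simpl finval in HN'.
    assert (T := rhoS_le_sub v w). lra. }
  destruct (constant_limit F Hm Hc (asymp_propagates F (s / 4) Hm Hc ltac:(lra) H0)) as [a Ha].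
  apply (Hnc (fun n => h (phi n)) (fun _ => a) Ha). exists a. reflexivity.
- destruct Hreg as [k [B [rho [N' [HB [Hrho H]]]]]].
  (* Every K > M exceeds B, and discs of radius 1 / (K + 1) then lie within the radii [rho] and
     [2 * s]. *)
  destruct (nfloor_ex (B + / rho + / (2 * s))) as [M [HM1 HM2]].
  { assert (0 < / rho) by (apply Rinv_0_lt_compat; auto).
    assert (0 < / (2 * s)) by (apply Rinv_0_lt_compat; lra). lra. }
  set (n := max (max N N') (max (S M) (S (S k)))).
  destruct (Hh (phi n)) as [T [l [HT [Hl [Hb [Hsep Hlen]]]]]].
  set (K := S (phi n)) in *. set (w := h (phi n)) in *.
  assert (HnK : (n < K)%nat) by (unfold K; specialize (Hphin n); lia).
  assert (KM : INR M + 1 <= INR K) by (rewrite <- S_INR; apply le_INR; unfold n in HnK; lia).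
  assert (Kk : INR (S k) <= INR K) by (apply le_INR; unfold n in HnK; lia).
  assert (K2 : 2 <= INR K) by (change 2 with (INR 2); apply le_INR; unfold n in HnK; lia).
  assert (IR : 0 < / rho) by (apply Rinv_0_lt_compat; auto).
  assert (IS : 0 < / (2 * s)) by (apply Rinv_0_lt_compat; lra).
  assert (KR : / (INR K + 1) < rho).
  { rewrite <- (Rinv_inv rho). apply Rinv_lt_contravar; [apply Rmult_lt_0_compat|]; lra. }
  assert (KS : / (INR K + 1) < 2 * s).
  { rewrite <- (Rinv_inv (2 * s)). apply Rinv_lt_contravar; [apply Rmult_lt_0_compat|]; lra. }
  set (eta := INR K * exp (- T / INR K)) in *.
  assert (Heta : 0 < eta) by (apply Rmult_lt_0_compat; [lra|apply exp_pos]).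
  (* Exactly k + 2 of the more than K points are kept, as [regular_seq] requires, and moved to the
     origin. *)
  set (l' := map (fun z => z - w)%C (firstn (S (S k)) l)).
  assert (Hl1 : forall z, In z l' -> Cmod (z - 0) < / (INR K + 1) /\ biglog T (F n z)).
  { intros z Hz. apply in_map_iff in Hz. destruct Hz as [y [<- Hy]].
    assert (Hy' : In y l).
    { rewrite <- (firstn_skipn (S (S k)) l). apply in_or_app. auto. }
    rewrite Forall_forall in Hl, Hb. specialize (Hl y Hy'). specialize (Hb y Hy').
    split.
    - replace (y - w - 0)%C with (y - w)%C by ring. exact Hl.
    - unfold F, translate. fold w.
      replace (Cadd (y - w)%C w) with y; [exact Hb|].
      apply injective_projections; simpl; ring. }
  (* In the bounded chart a large logarithm means a value of modulus at most e^-T, hence [kap] = 0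
     and [eps] = e^-T. *)
  assert (Hlast := H n ltac:(unfold n; lia) 0%C (exp (- T)) eta l' Heta).
  assert (Hfin : eta ^ S k <= B * exp (- T)).
  { apply Hlast.
    - unfold l'. rewrite length_map, length_firstn. unfold n in HnK. lia.
    - apply Forall_forall. intros z Hz. destruct (Hl1 z Hz). lra.
    - apply separated_translate, separated_firstn, Hsep.
    - apply Forall_forall. intros z Hz. destruct (Hl1 z Hz) as [Z1 Z2].
      destruct (Hv n ltac:(unfold n; lia) z ltac:(lra)) as [v [Ev Bv]].
      rewrite Ev. simpl finval. replace (v - 0)%C with v by (apply injective_projections; simpl; ring).
      apply biglog_small; auto; [lra|]. rewrite <- Ev. apply biglog_flip, Z2. }
  (* The contradiction: K >= k + 1 gives e^(-(k+1)T/K) >= e^-T, and K^(k+1) >= K > B. *)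
  unfold eta in Hfin. rewrite Rpow_mult_distr, exp_pow in Hfin.
  assert (P1 : INR K <= INR K ^ S k).
  { change (INR K ^ S k) with (INR K * INR K ^ k).
    rewrite <- (Rmult_1_r (INR K)) at 1. apply Rmult_le_compat_l; [lra|].
    apply pow_R1_Rle. lra. }
  assert (P2 : exp (- T) <= exp (INR (S k) * (- T / INR K))).
  { assert (E : - T <= INR (S k) * (- T / INR K)).
    { apply Rmult_le_reg_r with (INR K); [lra|].
      replace (INR (S k) * (- T / INR K) * INR K) with (- (INR (S k) * T)) by (field; lra). nra. }
    destruct (Rle_lt_or_eq_dec _ _ E) as [E'|E']; [left; apply exp_increasing, E'|rewrite <- E'; lra]. }
  assert (P3 := exp_pos (- T)).
  assert (P4 : INR K * exp (- T) <= INR K ^ S k * exp (INR (S k) * (- T / INR K))).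
  { apply Rmult_le_compat; lra. }
  assert (P5 : INR K * exp (- T) <= B * exp (- T)) by lra.
  apply Rmult_le_reg_r in P5; auto. lra.
Qed.

(** * Integration over circles *)

(** A separated family that is not yet a net can be enlarged by one point; without a net of the
    required kind this would go on up to K + 1 points. *)
Lemma maximal_separated (X : Type) (D : X -> X -> R) (P : X -> Prop) (eta : R) (K : nat) :
  (forall l, Forall P l -> ForallOrdPairs (fun a b => eta <= D a b) l -> (length l <= K)%nat) ->
  exists l, Forall P l /\ (length l <= K)%nat /\
    forall x, P x -> exists y, In y l /\ D x y < eta.
Proof.
intros H. apply NNPP. intros N.
assert (Ex : forall n, exists l, Forall P l /\ ForallOrdPairs (fun a b => eta <= D a b) l /\ length l = n).
{ induction n as [|n [l [L1 [L2 L3]]]].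
  - exists nil. repeat constructor.
  - apply NNPP. intros N2. apply N. exists l. split; [|split]; auto.
    intros x Hx. apply NNPP. intros N3. apply N2. exists (x :: l).
    split; [|split]; [constructor; auto| |simpl; congruence].
    constructor; auto. apply Forall_forall. intros y Hy.
    apply Rnot_lt_le. intros Hlt. apply N3. exists y. auto. }
destruct (Ex (S K)) as [l [L1 [L2 L3]]]. specialize (H l L1 L2). lia.
Qed.

(** On [0, 1] the cosine is at least cos (pi / 3) = 1 / 2, because pi > 3. *)
Lemma sin_ge_half (y : R) : 0 <= y <= 1 -> y / 2 <= sin y.
Proof.
intros [H0 H1]. destruct (Req_dec y 0) as [->|N]; [rewrite sin_0; lra|].
destruct (MVT_cor2 sin cos 0 y ltac:(lra)) as [c [E Hc]].
{ intros c _. apply derivable_pt_lim_sin. }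
rewrite sin_0 in E. assert (P := PI2_3_2). unfold PI2 in P.
assert (Hcos : cos (PI / 3) <= cos c).
{ apply cos_decr_1; lra. }
rewrite cos_PI3 in Hcos. nra.
Qed.

Lemma circ_chord (c : C) (r t t' : R) : 0 < r ->
  Cmod ((circ c r t : C) - (circ c r t' : C)) = 2 * r * Rabs (sin ((t - t') / 2)).
Proof.
intros Hr.
assert (E : Cmod ((circ c r t : C) - (circ c r t' : C)) ^ 2 = (2 * r * Rabs (sin ((t - t') / 2))) ^ 2).
{ rewrite Cmod_sqr, !Rpow_mult_distr, pow2_abs. simpl fst; simpl snd.
  assert (A1 := cos_minus t t'). assert (A2 := sin2_cos2 t). assert (A3 := sin2_cos2 t').
  assert (A4 := cos_2a_sin ((t - t') / 2)).
  replace (2 * ((t - t') / 2)) with (t - t') in A4 by field.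
  unfold Rsqr in *. nra. }
rewrite <- (sqrt_pow2 (Cmod _)) by apply Cmod_ge_0. rewrite E. apply sqrt_pow2.
apply Rmult_le_pos; [lra|apply Rabs_pos].
Qed.

Lemma chord_le_arc (c : C) (r t t' : R) : 0 < r ->
  Cmod ((circ c r t : C) - (circ c r t' : C)) <= r * Rabs (t - t').
Proof.
intros Hr. rewrite circ_chord by auto.
assert (S : Rabs (sin ((t - t') / 2)) <= Rabs ((t - t') / 2)).
{ generalize ((t - t') / 2). intros x.
  assert (P : forall y, 0 < y -> Rabs (sin y) <= y).
  { intros y Hy. assert (Q := sin_lt_x y Hy). destruct (Rle_dec y 1) as [L|L].
    - rewrite Rabs_pos_eq; [lra|]. assert (T := sin_ge_half y ltac:(lra)). lra.
    - apply Rabs_le. assert (B := SIN_bound y). lra. }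
  destruct (Rtotal_order x 0) as [L|[->|L]].
  - rewrite <- (Rabs_Ropp (sin x)), <- sin_neg. rewrite (Rabs_left x) by auto. apply P. lra.
  - rewrite sin_0, Rabs_R0. lra.
  - rewrite (Rabs_pos_eq x) by lra. apply P. lra. }
rewrite Rabs_div, (Rabs_pos_eq 2) in S by lra. nra.
Qed.

(** The restriction on the angles excludes pairs near 0 and 2 pi, whose chord is short although the
    parameters are far apart. *)
Lemma arc_le_chord (c : C) (r t t' : R) : 0 < r -> Rabs (t - t') <= 1 ->
  r * Rabs (t - t') <= 2 * Cmod ((circ c r t : C) - (circ c r t' : C)).
Proof.
intros Hr Hd. rewrite circ_chord by auto.
assert (P := Rabs_pos (t - t')).
assert (S := sin_ge_half (Rabs (t - t') / 2) ltac:(lra)).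
assert (E : sin (Rabs (t - t') / 2) <= Rabs (sin ((t - t') / 2))).
{ unfold Rabs at 1. destruct (Rcase_abs (t - t')).
  - replace (- (t - t') / 2) with (- ((t - t') / 2)) by field. rewrite sin_neg.
    rewrite <- Rabs_Ropp. apply Rle_abs.
  - apply Rle_abs. }
nra.
Qed.

(** The arc lies in a disc of radius 1 / (K + 1) about its initial point, so a maximal separated
    family in the level set has at most K members. Chords below the separation become angles below
    twice the separation over r. *)
Lemma arc_cover (f : Cpx -> Csph) (K : nat) (c : C) (r a b T : R) : (1 <= K)%nat -> 0 < r -> a <= b ->
  b - a <= 1 -> r * (b - a) < / (INR K + 1) -> INR K <= T ->
  (forall (w : C) (T : R) (l : list C), INR K <= T ->
    Forall (fun z => Cmod (z - w) < / (INR K + 1)) l ->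
    Forall (fun z => biglog T (f z)) l ->
    separated (INR K * exp (- T / INR K)) l -> (length l <= K)%nat) ->
  exists L : list R, (length L <= K)%nat /\
    forall t, a <= t <= b -> biglog T (f (circ c r t)) ->
      exists tau, In tau L /\ Rabs (t - tau) <= 2 * (INR K * exp (- T / INR K)) / r.
Proof.
intros HK Hr Hab Hab1 Hsmall HT H.
set (eta := INR K * exp (- T / INR K)) in *.
destruct (maximal_separated R (fun t t' => Cmod ((circ c r t : C) - (circ c r t' : C)))
  (fun t => a <= t <= b /\ biglog T (f (circ c r t))) eta K) as [L [L1 [L2 L3]]].
{ intros l Hl Hsep. rewrite <- (length_map (circ c r) l).
  rewrite Forall_forall in Hl.
  apply (H (circ c r a) T); auto.
  - apply Forall_forall. intros z Hz. apply in_map_iff in Hz. destruct Hz as [t [<- Ht]].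
    destruct (Hl t Ht) as [Ht1 _]. apply Rle_lt_trans with (2 := Hsmall).
    apply Rle_trans with (1 := chord_le_arc c r t a Hr). rewrite Rabs_pos_eq by lra. nra.
  - apply Forall_forall. intros z Hz. apply in_map_iff in Hz. destruct Hz as [t [<- Ht]].
    apply (Hl t Ht).
  - clear Hl. unfold separated. induction Hsep as [|t l Ht Hl IH]; simpl; constructor; auto.
    apply Forall_forall. intros z Hz. apply in_map_iff in Hz. destruct Hz as [t' [<- Ht']].
    rewrite Forall_forall in Ht. apply Ht, Ht'. }
exists L. split; auto. intros t Ht Hb. destruct (L3 t (conj Ht Hb)) as [tau [Htau Hd]].
exists tau. split; auto. rewrite Forall_forall in L1. destruct (L1 tau Htau) as [Htau' _].
assert (A := arc_le_chord c r t tau Hr ltac:(apply Rabs_le; lra)).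
apply Rmult_le_reg_r with r; auto. unfold Rdiv. rewrite Rmult_assoc, Rinv_l by lra. lra.
Qed.

Lemma circle_cover (f : Cpx -> Csph) (K : nat) : (1 <= K)%nat ->
  (forall (w : C) (T : R) (l : list C), INR K <= T ->
    Forall (fun z => Cmod (z - w) < / (INR K + 1)) l ->
    Forall (fun z => biglog T (f z)) l ->
    separated (INR K * exp (- T / INR K)) l -> (length l <= K)%nat) ->
  forall (c : C) (r T : R), 1 < r -> INR K <= T ->
  exists L : list R, INR (length L) <= r * ((2 * PI * (INR K + 1) + 1) * INR K) /\
    forall t, 0 < t < 2 * PI -> biglog T (f (circ c r t)) ->
      exists tau, In tau L /\ Rabs (t - tau) <= 2 * (INR K * exp (- T / INR K)) / r.
Proof.
intros HK H c r T Hr HT. assert (HPI := PI_RGT_0).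
assert (IK : 1 <= INR K) by (change 1 with (INR 1); apply le_INR, HK).
set (x := 2 * PI * r * (INR K + 1)).
assert (Hx : 0 < x) by (unfold x; assert (0 < PI * r) by nra; nra).
(* M + 1 equal arcs are used; as M + 1 > x, each has length below 1 / (K + 1). *)
destruct (nfloor_ex x) as [M [HM1 HM2]]; [lra|].
assert (HMS : INR M + 1 = INR (S M)) by (rewrite S_INR; ring).
set (al := 2 * PI / INR (S M)).
assert (HS0 : 0 < INR (S M)) by (apply lt_0_INR; lia).
assert (Hal : 0 < al) by (apply Rdiv_lt_0_compat; lra).
assert (Hral : r * al < / (INR K + 1)).
{ unfold al. apply Rmult_lt_reg_r with (INR (S M) * (INR K + 1)); [nra|].
  replace (r * (2 * PI / INR (S M)) * (INR (S M) * (INR K + 1))) with x by (unfold x; field; lra).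
  replace (/ (INR K + 1) * (INR (S M) * (INR K + 1))) with (INR (S M)) by (field; lra). lra. }
assert (Hal1 : al <= 1).
{ assert (al <= r * al) by nra.
  assert (/ (INR K + 1) <= 1); [|lra]. rewrite <- Rinv_1 at 2. apply Rinv_le_contravar; lra. }
assert (Ind : forall j : nat, exists L : list R, (length L <= j * K)%nat /\
   forall t, 0 <= t < INR j * al -> biglog T (f (circ c r t)) ->
      exists tau, In tau L /\ Rabs (t - tau) <= 2 * (INR K * exp (- T / INR K)) / r).
{ induction j as [|j [L [L1 L2]]].
  - exists nil. split; [simpl; lia|]. intros t Ht. simpl in Ht. lra.
  - assert (Ej : INR (S j) * al = INR j * al + al) by (rewrite S_INR; ring).
    destruct (arc_cover f K c r (INR j * al) (INR j * al + al) T HK ltac:(lra) ltac:(lra) ltac:(lra)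
      ltac:(replace (INR j * al + al - INR j * al) with al by ring; exact Hral) HT H) as [L' [L1' L2']].
    exists (L ++ L'). split; [rewrite length_app; simpl; lia|].
    intros t Ht Hb. destruct (Rlt_dec t (INR j * al)) as [Hlt|Hge].
    + destruct (L2 t ltac:(lra) Hb) as [tau [Hin Hd]]. exists tau. split; auto.
      apply in_or_app. auto.
    + destruct (L2' t ltac:(lra) Hb) as [tau [Hin Hd]]. exists tau. split; auto.
      apply in_or_app. auto. }
destruct (Ind (S M)) as [L [L1 L2]]. exists L. split.
- apply le_INR in L1. rewrite mult_INR in L1. apply Rle_trans with (1 := L1).
  rewrite <- Rmult_assoc. apply Rmult_le_compat_r; [lra|].
  (* The one arc due to rounding is absorbed into a multiple of r because r > 1. *)
  apply Rle_trans with (x + 1); [lra|]. unfold x. nra.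
- intros t Ht. apply L2. unfold al.
  replace (INR (S M) * (2 * PI / INR (S M))) with (2 * PI) by (field; lra). lra.
Qed.

(** * Integrable majorants of the level sets *)

Lemma is_RInt_bump (h tau : R) : 0 < h ->
  is_RInt (fun t => 2 / (1 + ((t - tau) / h) ^ 2)) 0 (2 * PI)
    (2 * h * atan ((2 * PI - tau) / h) - 2 * h * atan ((0 - tau) / h)).
Proof.
intros Hh.
assert (Pos : forall t, 0 < 1 + ((t - tau) / h) ^ 2).
{ intros t. assert (T := pow2_ge_0 ((t - tau) / h)). lra. }
apply (is_RInt_derive (V := R_CompleteNormedModule) (fun t => 2 * h * atan ((t - tau) / h))).
- intros t _. evar_last.
  + apply (is_derive_scal (fun t => atan ((t - tau) / h)) t (2 * h)).
    apply (is_derive_comp atan (fun t => (t - tau) / h)); [apply is_derive_atan|].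
    auto_derive; [trivial|reflexivity].
  + unfold scal; simpl; unfold mult; simpl. unfold Rsqr. specialize (Pos t). simpl in Pos.
    field. split; [lra|]. intros E.
    replace (1 + (t - tau) / h * ((t - tau) / h * 1)) with
      (((t - tau) * (t - tau) + h * h) / (h * h)) in Pos by (field; lra).
    assert (0 < h * h) by nra. assert (0 <= (t - tau) * (t - tau)) by (apply Rle_0_sqr). nra.
- intros t _. apply (ex_derive_continuous (V := R_NormedModule)). auto_derive.
  apply Rgt_not_eq. apply Pos.
Qed.

(** Each bump 2 / (1 + ((t - tau) / h)^2) is at least 1 within h of [tau] and has integral 2 pi h
    over the whole line. The sum majorizes the indicator of the covered set and is integrable
    whatever that set looks like. *)
Lemma bump_sum (h : R) (L : list R) : 0 < h ->
  exists Phi : R -> R, ex_RInt Phi 0 (2 * PI) /\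
    RInt Phi 0 (2 * PI) <= INR (length L) * (2 * PI * h) /\
    (forall t, 0 <= Phi t) /\
    forall t, (exists tau, In tau L /\ Rabs (t - tau) <= h) -> 1 <= Phi t.
Proof.
intros Hh. induction L as [|tau L [Phi [P1 [P2 [P3 P4]]]]].
- exists (fun _ => 0). split; [apply ex_RInt_const|]. split; [|split].
  + rewrite RInt_const. unfold scal; simpl; unfold mult; simpl. lra.
  + intros; lra.
  + intros t [tau [[] _]].
- set (b := fun t => 2 / (1 + ((t - tau) / h) ^ 2)).
  assert (Hb := is_RInt_bump h tau Hh). fold b in Hb.
  assert (Pos : forall t, 0 < 1 + ((t - tau) / h) ^ 2).
  { intros t. assert (T := pow2_ge_0 ((t - tau) / h)). lra. }
  assert (B0 : forall t, 0 < b t) by (intros; apply Rdiv_lt_0_compat; auto; lra).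
  exists (fun t => b t + Phi t). split; [|split; [|split]].
  + apply (ex_RInt_plus (V := R_NormedModule)); auto. eexists; exact Hb.
  + rewrite (RInt_plus (V := R_CompleteNormedModule) b Phi); auto; [|eexists; exact Hb].
    change (RInt b 0 (2 * PI) + RInt Phi 0 (2 * PI) <= INR (length (tau :: L)) * (2 * PI * h)).
    rewrite (is_RInt_unique _ _ _ _ Hb).
    simpl length. rewrite S_INR.
    assert (A1 := atan_bound ((2 * PI - tau) / h)). assert (A2 := atan_bound ((0 - tau) / h)). nra.
  + intros t. specialize (B0 t). specialize (P3 t). lra.
  + intros t [tau' [[<-|Hin] Hd]].
    * assert (1 <= b t); [|specialize (P3 t); lra].
      assert (Q : ((t - tau) / h) ^ 2 <= 1).
      { rewrite <- pow2_abs. rewrite <- (pow1 2). apply pow_incr. split; [apply Rabs_pos|].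
        rewrite Rabs_div, (Rabs_pos_eq h) by lra.
        apply Rmult_le_reg_r with h; auto. unfold Rdiv. rewrite Rmult_assoc, Rinv_l; lra. }
      unfold b. apply Rmult_le_reg_r with (1 + ((t - tau) / h) ^ 2); auto.
      unfold Rdiv at 2. rewrite Rmult_assoc, Rinv_l by (apply Rgt_not_eq, Pos). lra.
    * specialize (P4 t (ex_intro _ tau' (conj Hin Hd))). specialize (B0 t). lra.
Qed.

(** The part of [u] between the levels K + i and K + i + 1 is at most 1 and lives on a set covered
    by intervals of total size of order A q^i; the layers add up to a geometric sum. *)
Lemma layer_cake (u : R -> R) (K A q : R) : 0 <= K -> 0 <= A -> 0 < q < 1 ->
  (forall i : nat, exists (L : list R) (h : R), 0 < h /\ INR (length L) * h <= A * q ^ i /\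
     forall t, 0 < t < 2 * PI -> K + INR i < u t ->
       exists tau, In tau L /\ Rabs (t - tau) <= h) ->
  forall M : nat, exists Phi : R -> R, ex_RInt Phi 0 (2 * PI) /\
    RInt Phi 0 (2 * PI) <= 2 * PI * K + 2 * PI * (A * ((1 - q ^ M) / (1 - q))) /\
    forall t, 0 < t < 2 * PI -> Rmin (u t) (K + INR M) <= Phi t.
Proof.
intros HK HA Hq H. assert (HPI := PI_RGT_0). induction M as [|M [Phi [P1 [P2 P3]]]].
- exists (fun _ => K). split; [apply ex_RInt_const|]. split.
  + rewrite RInt_const. unfold scal; simpl; unfold mult; simpl.
    replace ((1 - 1) / (1 - q)) with 0 by (field; lra). lra.
  + intros t _. simpl. rewrite Rplus_0_r. apply Rmin_r.
- destruct (H M) as [L [h [Hh [HL Hcov]]]].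
  destruct (bump_sum h L Hh) as [Psi [S1 [S2 [S3 S4]]]].
  exists (fun t => Phi t + Psi t). split; [|split].
  + apply (ex_RInt_plus (V := R_NormedModule)); auto.
  + rewrite (RInt_plus (V := R_CompleteNormedModule) Phi Psi); auto.
    change (RInt Phi 0 (2 * PI) + RInt Psi 0 (2 * PI) <=
      2 * PI * K + 2 * PI * (A * ((1 - q ^ S M) / (1 - q)))).
    replace ((1 - q ^ S M) / (1 - q)) with ((1 - q ^ M) / (1 - q) + q ^ M) by (simpl; field; lra).
    nra.
  + intros t Ht. specialize (P3 t Ht). rewrite S_INR.
    (* Raising the cut by 1 matters only where [u] exceeds [K + INR M], and there the new summand is
       at least 1. *)
    destruct (Rlt_dec (K + INR M) (u t)) as [Hlt|Hge].
    * specialize (S4 t (Hcov t Ht Hlt)). rewrite Rmin_right in P3 by lra.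
      assert (T := Rmin_r (u t) (K + (INR M + 1))). lra.
    * specialize (S3 t). rewrite Rmin_left in P3 by lra.
      assert (T := Rmin_l (u t) (K + (INR M + 1))). lra.
Qed.

Lemma abslog_trunc_le (n : nat) (a : Csph) : abslog_trunc n a <= INR n.
Proof.
destruct a as [z|]; simpl; [|lra]. destruct (Req_EM_T (Cnorm z) 0); [lra|]. apply Rmin_r.
Qed.

Lemma abslog_trunc_biglog (n : nat) (a : Csph) (T : R) : T < abslog_trunc n a -> biglog T a.
Proof.
destruct a as [z|]; simpl; [|auto]. rewrite Cnorm_Cmod.
destruct (Req_EM_T (Cmod z) 0) as [E|E]; [auto|].
intros H. right. assert (L := Rmin_l (Rabs (ln (Cmod z))) (INR n)). lra.
Qed.

Theorem mainTheorem16 :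
  forall f : Cpx -> Csph, meromorphic f -> N1 f ->
  exists Cst : R,
    forall (c : Cpx) (r : R), 1 < r ->
    forall (n : nat)
      (pr : Riemann_integrable (fun t => abslog_trunc n (f (circ c r t))) 0 (2 * PI)),
      RiemannInt pr < Cst.
Proof.
intros f Hmer HN. destruct (uniform_count f Hmer HN) as [K [HK H]].
assert (HPI := PI_RGT_0).
assert (IK : 1 <= INR K) by (change 1 with (INR 1); apply le_INR, HK).
set (D := (2 * PI * (INR K + 1) + 1) * INR K).
assert (HD : 0 < D) by (unfold D; nra).
set (q := exp (- / INR K)).
assert (IKi : 0 < / INR K) by (apply Rinv_0_lt_compat; lra).
assert (Hq : 0 < q < 1).
{ split; [apply exp_pos|]. rewrite <- exp_0. apply exp_increasing. lra. }
(* At most r D intervals of half-width 2 K exp (- T / K) / r: the product is free of r. *)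
set (A := D * (2 * INR K)).
assert (HA : 0 < A) by (unfold A; nra).
(* The sum of the full geometric series replaces the partial sums, and the final 1 makes the
   inequality strict. *)
exists (2 * PI * INR K + 2 * PI * (A * (1 / (1 - q))) + 1).
intros c r Hr n pr. rewrite <- RInt_Reals.
set (u := fun t => abslog_trunc n (f (circ c r t))).
(* The truncated function never exceeds n, so n layers above K dominate it completely. *)
destruct (layer_cake u (INR K) A q ltac:(lra) ltac:(lra) Hq) with (M := n) as [Phi [P1 [P2 P3]]].
{ intros i. assert (Ii := pos_INR i).
  destruct (circle_cover f K HK H c r (INR K + INR i) Hr ltac:(lra)) as [L [L1 L2]].
  set (h := 2 * (INR K * exp (- (INR K + INR i) / INR K)) / r) in *.
  assert (Hexp := exp_pos (- (INR K + INR i) / INR K)).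
  assert (Hh : 0 < h) by (apply Rdiv_lt_0_compat; [nra|lra]).
  exists L, h. split; [exact Hh|]. split.
  - apply Rle_trans with (r * D * h); [apply Rmult_le_compat_r; [lra|exact L1]|].
    (* The left side equals e^-1 q^i; the factor e^-1 is dropped. *)
    assert (E : exp (- (INR K + INR i) / INR K) <= q ^ i).
    { unfold q. rewrite exp_pow. left. apply exp_increasing.
      replace (- (INR K + INR i) / INR K) with (INR i * - / INR K - 1) by (field; lra). lra. }
    replace (r * D * h) with (A * exp (- (INR K + INR i) / INR K)) by (unfold A, h; field; lra).
    apply Rmult_le_compat_l; lra.
  - intros t Ht Hu. apply L2; auto. apply abslog_trunc_biglog with n, Hu. }
assert (Hq2 : (1 - q ^ n) / (1 - q) <= 1 / (1 - q)).
{ apply Rmult_le_compat_r; [left; apply Rinv_0_lt_compat; lra|].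
  assert (T := pow_lt q n ltac:(lra)). lra. }
assert (Hq3 : A * ((1 - q ^ n) / (1 - q)) <= A * (1 / (1 - q))) by (apply Rmult_le_compat_l; lra).
assert (Hle : RInt u 0 (2 * PI) <= RInt Phi 0 (2 * PI)).
{ apply RInt_le; auto; [lra|apply ex_RInt_Reals_1, pr|].
  intros t Ht. specialize (P3 t Ht). rewrite Rmin_left in P3; auto.
  assert (T := abslog_trunc_le n (f (circ c r t))). unfold u. lra. }
nra.
Qed.
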